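(* Let $X=Y=[0,1)$ with Lebesgue measure $\lambda$, and let $S_1:X\to X$, $S_2:Y\to Y$ be invertible $\lambda$-preserving transformations such that the $\mathbb{Z}$-systems $(S_1,X,\lambda)$ and $(S_2,Y,\lambda)$ are weakly mixing. With $\mathcal{M}$, $\mathrm{P}_{\mathcal{M}}$, $L_v$ and $\mu((0,v])$ as in the context, define the $\mathbb{R}^2$-action on $\hat\Omega=\mathcal{M}^2\times X\times Y$ by $$\hat L_{v,w}(\mu,\nu,x,y)=\big(L_v\mu,\ L_w\nu,\ S_1^{\mu((0,v])}x,\ S_2^{\nu((0,w])}y\big),\qquad (v,w)\in\mathbb{R}^2 .$$ Then the $\mathbb{R}^2$-system $\big((\hat L_{v,w})_{(v,w)\in\mathbb{R}^2},\hat\Omega,\mathrm{P}_{\mathcal{M}}^{\otimes 2}\otimes\lambda^{\otimes 2}\big)$ is weakly mixing.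
   Context: $\mathcal{M}$ is the space of locally finite configurations of points in $\mathbb{R}$ (identified with integer-valued measures all of whose atoms have mass $1$), $\mathrm{P}_{\mathcal{M}}$ is the law of the Poisson point process of intensity $1$ on $\mathbb{R}$, and for $\mu=\sum_i\delta_{a_i}$, $L_v\mu=\sum_i\delta_{a_i-v}$. For $v\ge0$, $\mu((0,v])$ is the number of points of $\mu$ in $(0,v]$; for $v<0$ it is minus the number of points of $\mu$ in $(v,0]$. A measure-preserving $G$-action ($G=\mathbb{Z}^d$ or $\mathbb{R}^d$) on $(\Omega,P)$ is weakly mixing if for all measurable $A,B$, $\lim_{R\to\infty}(2R)^{-d}\int_{|g|\le R}|P(T_gA\cap B)-P(A)P(B)|\,dg=0$ with $|g|=\max_i|g_i|$ and $dg$ Lebesgue (resp. counting) measure; equivalently the diagonal action on $\Omega\times\Omega$ is ergodic. *)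

(* Defs.v *)
From HB Require Import structures.
From mathcomp Require Import all_boot all_order all_algebra finmap.
From mathcomp Require Import all_classical all_reals all_analysis.

Set Implicit Arguments.
Unset Strict Implicit.
Unset Printing Implicit Defensive.

Import Order.TTheory GRing.Theory Num.Theory.
Import numFieldNormedType.Exports.

Local Open Scope classical_set_scope.
Local Open Scope ring_scope.

Section Defs.
Variable R : realType.

Definition RL := measurableTypeR R.

Definition locfin (A : set R) :=
  forall r : R, finite_set (A `&` [set x | `|x| <= r]).

Record config := Config { cpts : set R ; cptsP : locfin cpts }.

Lemma locfin0 : locfin set0.
Proof. by move=> r; rewrite set0I. Qed.

HB.instance Definition _ := gen_eqMixin config.
HB.instance Definition _ := gen_choiceMixin config.
HB.instance Definition _ := isPointed.Build config (Config locfin0).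

(** number of points of [mu] in [B] (meaningful for bounded [B]) *)
Definition count (mu : config) (B : set R) : nat :=
  #|` fset_set (cpts mu `&` B) |.

Definition bounded_set (B : set R) := exists r : R, B `<=` [set x | `|x| <= r].

Definition count_gen : set (set config) :=
  [set E | exists (B : set RL) (n : nat),
      [/\ measurable B, bounded_set B & E = [set mu | count mu B = n]]].

Definition configM := g_sigma_algebraType count_gen.

(** shift L_v mu = sum_i delta_{a_i - v} *)
Lemma locfin_shift (v : R) (mu : config) :
  locfin ((fun a => a - v) @` cpts mu).
Proof.
move=> r.
apply: (@sub_finite_set _ _ ((fun a => a - v) @` (cpts mu `&` [set x | `|x| <= r + `|v|]))).
  move=> y [[a ma <-]] /= hy; exists a => //; split => //=.
  have -> : a = (a - v) + v by rewrite subrK.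
  by apply: (le_trans (ler_normD _ _)); rewrite lerD2r.
by apply: finite_image; apply: cptsP.
Qed.

Definition Lshift (v : R) (mu : config) : config :=
  Config (locfin_shift v mu).

Definition scount (mu : config) (v : R) : int :=
  if 0 <= v then (count mu `]0, v])%:Z else - (count mu `]v, 0])%:Z.

Definition zit (T : Type) (S Sinv : T -> T) (k : int) : T -> T :=
  match k with
  | Posz n => iter n S
  | Negz n => iter n.+1 Sinv
  end.

Definition poisson_prob (lam : R) (k : nat) : R :=
  lam ^+ k / k`!%:R * expR (- lam).

Definition is_poisson_law (P : set configM -> \bar R) :=
  forall (k : nat) (B : 'I_k -> set RL) (n : 'I_k -> nat),
    (forall i, measurable (B i) /\ bounded_set (B i)) ->
    (forall i j, i != j -> B i `&` B j = set0) ->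
    P (\bigcap_(i in [set: 'I_k]) [set mu : configM | count mu (B i) = n i])
    = (\prod_(i < k) poisson_prob (fine (lebesgue_measure (B i))) (n i))%:E.

(** ** X = Y = [0,1) with Lebesgue measure (modelled on R; points outside
    [0,1) form a null set) *)
Definition I01 : set RL := `[0%R, 1%R[.

Definition lamI (A : set RL) : \bar R := lebesgue_measure (A `&` I01).

Definition inv_mp (S Sinv : RL -> RL) :=
  [/\ measurable_fun setT S, measurable_fun setT Sinv,
      (forall x, I01 x ->
         [/\ I01 (S x), I01 (Sinv x), Sinv (S x) = x & S (Sinv x) = x]) &
      (forall A : set RL, measurable A -> lamI (S @^-1` A) = lamI A)].

Definition weakly_mixing_Z d (T : measurableType d) (m : set T -> \bar R)
    (S Sinv : T -> T) :=
  forall A B : set T, measurable A -> measurable B ->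
    (fun N : nat => ((2 * N%:R)^-1)%:E *
       \sum_(i < (2 * N).+1)
          `| m (zit S Sinv (i%:Z - N%:Z) @^-1` A `&` B) - m A * m B |)%E
    @ \oo --> 0%E.

Definition RL2 := (RL * RL)%type.

Definition box (r : R) : set RL2 := [set g | `|g.1| <= r /\ `|g.2| <= r].

Definition weakly_mixing_R2 d (T : measurableType d) (m : set T -> \bar R)
    (act : R -> R -> T -> T) :=
  (forall v w, measurable_fun setT (act v w) /\
     forall A : set T, measurable A -> m (act v w @^-1` A) = m A) /\
  (forall A B : set T, measurable A -> measurable B ->
    (fun r : R => ((2 * r) ^- 2)%:E *
       \int[(@lebesgue_measure R \x @lebesgue_measure R)%E]_(g in box r)
          `| m (act g.1 g.2 @^-1` A `&` B) - m A * m B |)%E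
    @ +oo%R --> 0%E).

Definition Omega := (((configM * configM) * RL) * RL)%type.

Definition hatL (S1 S1inv S2 S2inv : RL -> RL) (v w : R) (o : Omega) : Omega :=
  let: (mu, nu, x, y) := o in
  (Lshift v mu, Lshift w nu,
   zit S1 S1inv (scount mu v) x, zit S2 S2inv (scount nu w) y).

Definition hatP (P : set configM -> \bar R) : set Omega -> \bar R :=
  (((P \x P) \x lamI) \x lamI)%E.

End Defs.

(* Main.v *)
(* The action is the product of two R-actions (mu, x) |-> (L_v mu, S^{mu((0,v])} x),
   so the correlation defect of a product of rectangles is at most the sum of
   the defects of its two factors, a function of v plus a function of w.  For
   one factor, with E and F determined by void events {mu(B) = 0}, shifting far
   apart makes E and F independent, and what remains is at most
   E |psi(mu((0,v]))| with psi(k) = lambda(S^-k C cap D) - lambda(C) lambda(D).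
   Since int_0^r P(N_v = n) dv = P(N_r > n) for a Poisson variable N_v of mean v,
   the integral of this quantity over 0 < v < r is a sum of |psi(n)| with
   weights that decrease in n and add up to r, and the Cesaro convergence of
   |psi| to 0 makes it o(r).  Void events form a pi-system generating the
   sigma-algebra of configurations, so two applications of Dynkin's theorem
   extend the estimate to all events. *)

Require Import Defs.
From HB Require Import structures.
From mathcomp Require Import all_boot all_order all_algebra finmap.
From mathcomp Require Import all_classical all_reals all_analysis.
From mathcomp Require Import measurable_realfun ring lra.

Set Implicit Arguments.
Unset Strict Implicit.
Unset Printing Implicit Defensive.

Import Order.TTheory GRing.Theory Num.Theory.
Import numFieldNormedType.Exports.

Local Open Scope classical_set_scope.
Local Open Scope ring_scope.

(** * Poisson averages of Cesaro-null sequences *)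

(** The event that a shifted void event and a fixed one both occur is in general not independent of
    the number N_v of points crossed, since their windows may meet []0, v]]. A general event of the
    product space has no product structure, so nothing bounds its defect directly by a function of v
    plus a function of w. But replacing an event by a subset changes its correlations by at most the
    measure of the difference, uniformly in (v, w). Defects are therefore compared with such sums up
    to an arbitrary constant error. The class of events dominated in this way is stable under proper
    differences, by the triangle inequality, and under increasing unions, where the constant absorbs
    the approximation error. This stability is what Dynkin's theorem asks for. *)

Section PoissonCesaro.
Variable R : realType.
Implicit Types (theta Q : nat -> R) (v r eps C : R).

Let pp (n : nat) (v : R) : R := Defs.poisson_prob v n.
Local Notation mu := (@lebesgue_measure R).

(** Summation by parts: the partial sums of [theta] exceed those of the constant [eps] by at most
    [C], and nonincreasing weights charge this excess only at the initial weight. *)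
Lemma abel_bound theta Q eps C :
  (forall N, \sum_(n < N) theta n <= eps * N%:R + C) ->
  (forall n, 0 <= Q n) -> (forall n, Q n.+1 <= Q n) ->
  forall N, \sum_(n < N) theta n * Q n <= C * Q 0%N + eps * \sum_(n < N) Q n.
Proof.
move=> thetaC Q0 Qd N.
pose S N := \sum_(n < N) theta n - eps * N%:R.
have SC M : S M <= C by rewrite /S lerBlDl.
(* The nonnegative boundary term [(C - S N) * Q N] of the summation by parts is kept so that the
   induction closes. *)
suff : \sum_(n < N) theta n * Q n - eps * \sum_(n < N) Q n
    <= C * Q 0%N - (C - S N) * Q N.
  by have := mulr_ge0 (_ : 0 <= C - S N) (Q0 N); rewrite subr_ge0 => /(_ (SC N)); lra.
elim: N => [|N ih]; first by rewrite /S !big_ord0; lra.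
rewrite !big_ord_recr /= mulrDr.
have : (C - S N.+1) * Q N.+1 <= (C - S N.+1) * Q N.
  by apply: ler_wpM2l => //; rewrite subr_ge0.
have -> : S N.+1 = S N + (theta N - eps).
  by rewrite /S big_ord_recr /= -natr1; ring.
lra.
Qed.

Lemma poisson_prob_ge0 n v : 0 <= v -> 0 <= pp n v.
Proof. by move=> v0; rewrite /pp /Defs.poisson_prob !mulr_ge0// ?exprn_ge0// expR_ge0. Qed.

Lemma sum_poisson_prob_le1 N v : 0 <= v -> \sum_(n < N) pp n v <= 1.
Proof.
move=> v0; rewrite -mulr_suml.
rewrite expRN ler_pdivrMr ?expR_gt0// mul1r.
have -> : \sum_(i < N) v ^+ i / i`!%:R = series (exp_coeff v) N.
  by rewrite /series /= big_mkord.
apply: nondecreasing_cvgn_le; last exact: is_cvg_series_exp_coeff.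
apply/nondecreasing_seqP => n; rewrite /series /= big_nat_recr//= lerDl.
by rewrite /exp_coeff divr_ge0// exprn_ge0.
Qed.

(** The function is the tail P(N_x > n) of a Poisson variable of mean x. The derivative of [pp k.+1]
    is [pp k - pp k.+1], so the derivative of the sum telescopes. *)
Lemma is_derive_sum_poisson_prob n v :
  is_derive v 1 (fun x => 1 - \sum_(k < n.+1) pp k x) (pp n v).
Proof.
elim: n => [|n ih].
  have -> : (fun x => 1 - \sum_(k < 1) pp k x) = (fun x => 1 - expR (- x)).
    apply/funext => x; rewrite big_ord_recr big_ord0/= /pp /Defs.poisson_prob.
    by rewrite expr0 fact0 divr1 mul1r add0r.
  apply: is_derive_eq.
  rewrite /pp /Defs.poisson_prob/= expr0 divr1 mul1r /GRing.scale/=; ring.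
pose G (x : R) : R := (n.+1`!%:R^-1 * x ^+ n.+1) * expR (- x).
have dG : is_derive v 1 G (pp n v - pp n.+1 v).
  have dX : is_derive v 1 (fun x : R => n.+1`!%:R^-1 * x ^+ n.+1 : R)
      (n.+1`!%:R^-1 * (n.+1%:R * v ^+ n)).
    rewrite (_ : (fun _ => _) = n.+1`!%:R^-1 \*: ((@id R) ^+ n.+1)); last first.
      by apply/funext => x; rewrite /= exprfctE.
    apply: is_derive_eq (is_deriveZ _ (is_deriveX n.+1 (is_derive_id v 1))) _.
    by rewrite /GRing.scale/= mulr1.
  have dE : is_derive v 1 (fun x : R => expR (- x)) (- expR (- v)).
    apply: is_derive_eq; rewrite /GRing.scale/=.
    ring.
  apply: is_derive_eq (is_deriveM dX dE) _.
  have nf : n`!%:R != 0 :> R by rewrite pnatr_eq0 -lt0n fact_gt0.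
  have n1 : n%:R + 1 != 0 :> R by rewrite natr1 pnatr_eq0.
  rewrite /pp /Defs.poisson_prob /GRing.scale/= factS natrM -natr1 exprS.
  field.
  by rewrite nf n1.
have -> : (fun x => 1 - \sum_(k < n.+2) pp k x) =
   (fun x => 1 - \sum_(k < n.+1) pp k x) - G.
  apply/funext => x; rewrite [in LHS]big_ord_recr/= /pp /Defs.poisson_prob /G.
  rewrite -[RHS]/(_ - _); ring.
apply: is_derive_eq (is_deriveB ih dG) _.
ring.
Qed.

Lemma continuous_poisson_prob n : continuous (pp n).
Proof.
move=> x; apply: cvgM.
  by apply: cvgMl; exact: exprn_continuous.
apply: (@continuous_comp _ _ _ (@GRing.opp R) expR); first exact: opp_continuous.
exact: continuous_expR.
Qed.

Lemma measurable_poisson_prob n : measurable_fun [set: R] (pp n).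
Proof. by apply: continuous_measurable_fun; exact: continuous_poisson_prob. Qed.

Lemma integral_poisson_prob n r : 0 <= r ->
  (\int[mu]_(x in `[0%R, r]) (pp n x)%:E = (1 - \sum_(k < n.+1) pp k r)%:E)%E.
Proof.
rewrite le_eqVlt => /predU1P[<-|r0].
  rewrite set_itv1 integral_set1 big_ord_recl big1/=.
    by rewrite /pp /Defs.poisson_prob expr0 fact0 divr1 oppr0 expR0 mul1r addr0 subrr.
  by move=> i _; rewrite /pp /Defs.poisson_prob expr0n/= !mul0r.
rewrite (@continuous_FTC2 _ _ (fun x => 1 - \sum_(k < n.+1) pp k x))//.
- rewrite -EFinB; congr EFin.
  rewrite [X in _ - (_ - X)](_ : _ = 1) ?subrr ?subr0//.
  rewrite big_ord_recl big1/=.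
    by rewrite /pp /Defs.poisson_prob expr0 fact0 divr1 oppr0 expR0 mul1r addr0.
  by move=> i _; rewrite /pp /Defs.poisson_prob expr0n/= !mul0r.
- by apply: continuous_subspaceT; exact: continuous_poisson_prob.
- have dF x := is_derive_sum_poisson_prob n x.
  have cF : continuous (fun x => 1 - \sum_(k < n.+1) pp k x).
    move=> x; apply: differentiable_continuous; apply/derivable1_diffP.
    by have [] := dF x.
  split.
  + by move=> x _; have [] := dF x.
  + by apply: cvg_at_right_filter; exact: cF.
  + by apply: cvg_at_left_filter; exact: cF.
- by move=> x _; rewrite derive1E; apply: derive_val; exact: is_derive_sum_poisson_prob.
Qed.

(** Each summand is the integral of [pp n] over [[0, r]], and at every point the masses [pp n x] add
    up to at most 1. *)
Lemma sum_integral_poisson_prob_le N r : 0 <= r ->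
  \sum_(n < N) (1 - \sum_(k < n.+1) pp k r) <= r.
Proof.
move=> r0; rewrite -lee_fin -sumEFin.
under eq_bigr do rewrite -integral_poisson_prob//.
rewrite -ge0_integral_sum//.
- apply: (@le_trans _ _ (\int[mu]_(x in `[0%R, r]) 1)%E).
    apply: ge0_le_integral => //.
    + move=> x /=; rewrite in_itv/= => /andP[x0 _]; apply: sume_ge0 => n _.
      by rewrite lee_fin poisson_prob_ge0.
    + apply: emeasurable_sum => n; apply/measurable_EFinP.
      by apply: measurable_funTS; exact: measurable_poisson_prob.
    + move=> x /=; rewrite in_itv/= => /andP[x0 _].
      by rewrite sumEFin lee_fin sum_poisson_prob_le1.
  rewrite integral_cst//= mul1e lebesgue_measure_itv/= lte_fin.
  by case: ifPn => _; rewrite ?oppr0 ?adde0 ?lee_fin.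
- move=> n; apply/measurable_EFinP.
  by apply: measurable_funTS; exact: measurable_poisson_prob.
- move=> n x /=; rewrite in_itv/= => /andP[x0 _].
  by rewrite lee_fin poisson_prob_ge0.
Qed.

(** The expectation of [theta] at a Poisson variable of mean [|v|]; the absolute value lets it serve
    shifts in both directions. *)
Definition poisson_average theta v : \bar R :=
  (\sum_(n <oo) (theta n * pp n `|v|)%:E)%E.

Lemma measurable_poisson_average theta : (forall n, 0 <= theta n) ->
  measurable_fun [set: R] (poisson_average theta).
Proof.
move=> theta0; apply: ge0_emeasurable_sum => //.
  by move=> n x _ _; rewrite lee_fin mulr_ge0// poisson_prob_ge0.
move=> n _; apply/measurable_EFinP; apply: measurable_funM => //.
by apply: (measurableT_comp (measurable_poisson_prob n)).
Qed.

(** [abel_bound] is applied to the tails P(N_r > n): they decrease in n, the first is at most 1, and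
    they sum to at most [r]. The factor 2 counts the two halves of [[-r, r]]. *)
Lemma integral_poisson_average_le theta eps C r :
  (forall n, 0 <= theta n) -> 0 <= eps -> 0 <= C -> 0 <= r ->
  (forall N, \sum_(n < N) theta n <= eps * N%:R + C) ->
  (\int[mu]_(x in `[(- r)%R, r]) poisson_average theta x <= (2 * (C + eps * r))%:E)%E.
Proof.
move=> theta0 eps0 C0 r0 thetaC.
have mp n D : measurable_fun D (fun x : R => (pp n `|x|)%:E).
  apply/measurable_EFinP; apply: measurable_funTS.
  by apply: (measurableT_comp (measurable_poisson_prob n)).
have half n : (\int[mu]_(x in `[0%R, r]) (pp n `|x|)%:E =
    (1 - \sum_(k < n.+1) pp k r)%:E)%E.
  rewrite -integral_poisson_prob//; apply: eq_integral => x.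
  by rewrite inE/= in_itv/= => /andP[x0 _]; rewrite ger0_norm.
have halfN n : (\int[mu]_(x in `[(- r)%R, 0%R]) (pp n `|x|)%:E =
    (1 - \sum_(k < n.+1) pp k r)%:E)%E.
  rewrite -integral_poisson_prob//.
  transitivity (\int[mu]_(x in `[(- r)%R, (- 0)%R]) ((pp n \o -%R) x)%:E)%E.
    rewrite oppr0; apply: eq_integral => x.
    by rewrite inE/= in_itv/= => /andP[_ x0]; rewrite ler0_norm.
  rewrite integration_by_substitution_oppr//.
    by apply: eq_integral => x _ /=; rewrite opprK.
  apply: continuous_subspaceT => x.
  by apply: continuous_comp; [exact: opp_continuous|exact: continuous_poisson_prob].
have both n : (\int[mu]_(x in `[(- r)%R, r]) (pp n `|x|)%:E <=
    (2 * (1 - \sum_(k < n.+1) pp k r))%:E)%E.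
  rewrite (_ : `[- r, r]%classic = `[- r, 0] `|` `]0, r]); last first.
    rewrite -itv_bndbnd_setU// ?bnd_simp//; first by rewrite lerNl oppr0.
  rewrite ge0_integral_setU//=; first last.
    - apply/disj_setPS => x [] /=; rewrite !in_itv/= => /andP[_ x0] /andP[].
      by rewrite ltNge x0.
    - by move=> x _; rewrite lee_fin poisson_prob_ge0.
    - exact: mp.
  rewrite halfN mulr_natl mulr2n [leRHS]EFinD leeD2l// -half.
  apply: ge0_subset_integral => //.
  - exact: mp.
  - by move=> x _; rewrite lee_fin poisson_prob_ge0.
  - by apply: subset_itv_oc_cc.
rewrite integral_nneseries//; first last.
- by move=> n x _; rewrite lee_fin mulr_ge0// poisson_prob_ge0.
- move=> n; apply/measurable_EFinP; apply: measurable_funM => //.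
  by apply/measurable_EFinP; exact: mp.
apply: lime_le.
  apply: is_cvg_nneseries => n _ _; apply: integral_ge0 => x _.
  by rewrite lee_fin mulr_ge0// poisson_prob_ge0.
apply: nearW => N; rewrite big_mkord.
apply: (@le_trans _ _ (\sum_(n < N) (2 * (theta n * (1 - \sum_(k < n.+1) pp k r)))%:E)%E).
  apply: lee_sum => n _.
  under eq_integral do rewrite EFinM.
  rewrite ge0_integralZl//; last first.
  - by rewrite lee_fin.
  - by move=> x _; rewrite lee_fin poisson_prob_ge0.
  - exact: mp.
  rewrite mulrCA EFinM; apply: lee_wpmul2l; first by rewrite lee_fin.
  exact: both.
rewrite sumEFin lee_fin -mulr_sumr ler_pM2l//.
have Q0 n : 0 <= 1 - \sum_(k < n.+1) pp k r.
  by rewrite subr_ge0 sum_poisson_prob_le1.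
have Qd n : 1 - \sum_(k < n.+2) pp k r <= 1 - \sum_(k < n.+1) pp k r.
  by rewrite lerB// [leRHS]big_ord_recr/= lerDl poisson_prob_ge0.
apply: (le_trans (abel_bound thetaC Q0 Qd N)).
apply: lerD.
  rewrite ler_piMr// gerBl; apply: sumr_ge0 => k _; exact: poisson_prob_ge0.
by apply: ler_wpM2l => //; exact: sum_integral_poisson_prob_le.
Qed.

End PoissonCesaro.

(** * Poisson configurations *)

Section Configurations.
Variable R : realType.
Implicit Types (mu : config R) (B : set R) (v r : R).

(** The interval between [b] and [a] contains no element of [s], so a rational chosen in it
    separates [a] from the smaller elements. *)
Lemma seq_pred_lt (s : seq R) (a : R) :
  exists2 b, b < a & forall x, x \in s -> x < a -> x <= b.
Proof.
elim: s => [|y s [b ba bs]]; first by exists (a - 1) => //; rewrite gtrBl.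
have [ya|ay] := ltP y a.
  exists (Num.max b y); first by rewrite gt_max ba.
  move=> x; rewrite inE => /predU1P[->|xs] xa; first by rewrite le_max lexx orbT.
  by rewrite le_max bs.
exists b => // x; rewrite inE => /predU1P[->|xs] xa; last exact: bs.
by rewrite leNgt xa in ay.
Qed.

Lemma seq_max (s : seq R) : s != [::] ->
  exists2 a, a \in s & forall x, x \in s -> x <= a.
Proof.
elim: s => // y [|z s] ih _.
  by exists y; rewrite ?inE// => x; rewrite inE => /eqP ->.
have [//|a aS aM] := ih; have [ya|ay] := leP y a.
  exists a; first by rewrite inE aS orbT.
  by move=> x; rewrite inE => /predU1P[->//|]; exact: aM.
exists y; first by rewrite inE eqxx.
by move=> x; rewrite inE => /predU1P[->//|/aM xa]; rewrite (le_trans xa)// ltW.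
Qed.

(** Emptiness rather than a zero [count]: [fset_set] sends an infinite set to the empty one, so the
    two conditions agree only where the configuration has finitely many points in [B]. *)
Definition void B : set (configM R) := [set mu : config R | cpts mu `&` B = set0].

Definition void_sets : set (set (configM R)) :=
  [set E | exists B : set (RL R), [/\ measurable B, Defs.bounded_set B & E = void B]].

Lemma bounded_setS B B' : B `<=` B' -> Defs.bounded_set B' -> Defs.bounded_set B.
Proof. by move=> BB' [r Br]; exists r; exact: subset_trans Br. Qed.

Lemma bounded_setU B B' : Defs.bounded_set B -> Defs.bounded_set B' ->
  Defs.bounded_set (B `|` B').
Proof.
move=> [r Br] [s Bs]; exists (Num.max r s) => x [/Br|/Bs] /= xr;
  by rewrite le_max xr ?orbT.
Qed.

Lemma voidI B B' : void B `&` void B' = void (B `|` B').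
Proof.
by apply/seteqP; split => mu; rewrite /void/= setIUr setU_eq0.
Qed.

Lemma finite_cptsI mu B : Defs.bounded_set B -> finite_set (cpts mu `&` B).
Proof.
by move=> [r Br]; apply: sub_finite_set (cptsP mu r); exact: setIS.
Qed.

Lemma count_eq0 B : Defs.bounded_set B ->
  [set mu : configM R | Defs.count mu B = 0%N] = void B.
Proof.
move=> bB; apply/seteqP; split => mu /=; rewrite /Defs.count /void/=.
  move/cardfs0_eq/fset_set_set0; apply; exact: finite_cptsI.
by move=> ->; rewrite fset_set0 cardfs0.
Qed.

Lemma countU mu B B' : Defs.bounded_set B -> Defs.bounded_set B' ->
  B `&` B' = set0 ->
  Defs.count mu (B `|` B') = (Defs.count mu B + Defs.count mu B')%N.
Proof.
move=> bB bB' BB'; rewrite /Defs.count setIUr fset_setU; try exact: finite_cptsI.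
rewrite cardfsU -fset_setI; try exact: finite_cptsI.
by rewrite setIACA BB' setI0 fset_set0 cardfs0 subn0.
Qed.

(* The largest point of mu in B is separated from the others by a rational q. *)
Lemma count_geS n B : Defs.bounded_set B ->
  [set mu : configM R | (n < Defs.count mu B)%N] =
  \bigcup_(q : rat) ([set mu : configM R | (n <= Defs.count mu (B `&` `]-oo, ratr q]))%N]
     `&` ~` void (B `&` `]ratr q, +oo[)).
Proof.
move=> bB.
have split q mu : Defs.count mu B =
    (Defs.count mu (B `&` `]-oo, q]) + Defs.count mu (B `&` `]q, +oo[))%N.
  rewrite -countU; first last.
  - rewrite setIACA (_ : `]-oo, q] `&` `]q, +oo[ = set0) ?setI0//.
    by apply/seteqP; split => x //= []; rewrite !in_itv/= andbT leNgt => /negP.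
  - by apply: bounded_setS bB; exact: subIsetl.
  - by apply: bounded_setS bB; exact: subIsetl.
  rewrite -setIUr (_ : _ `|` _ = setT) ?setIT//.
  by apply/seteqP; split => x //= _; rewrite !in_itv/= andbT; case: leP; [left|right].
have bq q : Defs.bounded_set (B `&` `]q, +oo[).
  by apply: bounded_setS bB; exact: subIsetl.
apply/seteqP; split => mu /=.
- move=> nB.
  have /seq_max[a aB amax] : (fset_set (cpts mu `&` B) : seq R) != [::].
    by apply/eqP => B0; move: nB; rewrite /Defs.count B0.
  have [b ba bmax] := seq_pred_lt (fset_set (cpts mu `&` B)) a.
  have [q] := rat_in_itvoo ba; rewrite in_itv/= => /andP[bq' qa].
  exists q => //.
  have E1 : cpts mu `&` (B `&` `]ratr q, +oo[) = [set a].
    apply/seteqP; split => x /=.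
    + move=> [mx [Bx]]; rewrite in_itv/= andbT => qx.
      have xB : x \in fset_set (cpts mu `&` B).
        by rewrite in_fset_set ?inE//; exact: finite_cptsI.
      apply/eqP; rewrite eq_le amax//= leNgt; apply/negP => xa.
      by have := bmax _ xB xa; rewrite leNgt (lt_trans bq').
    + move=> ->; move: aB; rewrite in_fset_set; last exact: finite_cptsI.
      by move=> /set_mem[ma Ba]; split => //; split => //=; rewrite in_itv/= andbT.
  split.
    move: nB; rewrite (split (ratr q)) {2}/Defs.count E1 fset_set1 cardfs1 addn1.
    by rewrite ltnS.
  by rewrite /void/= E1 => /seteqP[/(_ a erefl)].
- move=> [q _ [nq]] vq; rewrite (split (ratr q)) -addn1 leq_add// lt0n.
  by apply/eqP => c0; apply: vq; rewrite -(count_eq0 (bq _)).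
Qed.

Lemma setI_closed_void : setI_closed void_sets.
Proof.
move=> _ _ [B [mB bB ->]] [B' [mB' bB' ->]]; exists (B `|` B'); split.
- exact: measurableU.
- exact: bounded_setU.
- exact: voidI.
Qed.

Lemma bounded_set0 : Defs.bounded_set (set0 : set R).
Proof. by exists 0. Qed.

Lemma void_sets_setT : void_sets setT.
Proof.
exists set0; split => //; first exact: bounded_set0.
by apply/seteqP; split => // mu _; rewrite /void/= setI0.
Qed.

(** Thanks to this generation result, independence has to be checked on void events only. The
    counting events are recovered by induction on the number of points, for all bounded Borel sets
    at once, because a rational cut replaces [B] by its left part. *)
Lemma measurable_configM_void : @measurable _ (configM R) = <<s void_sets >>.
Proof.
apply/seteqP; split; last first.
  apply: smallest_sub; first exact: sigma_algebra_measurable.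
  move=> _ [B [mB bB ->]]; apply: sub_sigma_algebra.
  by exists B, 0%N; split => //; rewrite count_eq0.
apply: smallest_sub; first exact: smallest_sigma_algebra.
have ge n B : measurable (B : set (RL R)) -> Defs.bounded_set B ->
    (<<s void_sets >>) [set mu : configM R | (n <= Defs.count mu B)%N].
  elim: n B => [|n ih] B mB bB.
    rewrite [X in _ X](_ : _ = setT); last exact/seteqP.
    exact: (@measurableT _ (g_sigma_algebraType void_sets)).
  rewrite count_geS//.
  apply: (@bigcupT_measurable_rat _ (g_sigma_algebraType void_sets)) => q.
  apply: (@measurableI _ (g_sigma_algebraType void_sets)).
    apply: ih; first exact: measurableI.
    by apply: bounded_setS bB; exact: subIsetl.
  apply: (@measurableC _ (g_sigma_algebraType void_sets)).
  apply: sub_sigma_algebra; exists (B `&` `]ratr q, +oo[); split => //.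
    exact: measurableI.
  by apply: bounded_setS bB; exact: subIsetl.
move=> _ [B [n [mB bB ->]]].
rewrite [X in _ X](_ : _ = [set mu : configM R | (n <= Defs.count mu B)%N] `\`
   [set mu : configM R | (n < Defs.count mu B)%N]); last first.
  apply/seteqP; split => mu /=.
    by move=> ->; rewrite leqnn ltnn.
  by move=> [nB /negP]; rewrite -leqNgt => Bn; apply/eqP; rewrite eqn_leq Bn.
apply: (@measurableD _ (g_sigma_algebraType void_sets)); exact: ge.
Qed.

Lemma Lshift_preimage_void v B :
  (Lshift v : configM R -> configM R) @^-1` void B = void [set a | B (a - v)].
Proof.
apply/seteqP; split => mu; rewrite /void/= -!subset0.
  by move=> h a [ma Bav]; apply: (h (a - v)); split => //; exists a.
by move=> h _ [[a ma <-] Bav]; apply: (h a).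
Qed.

Lemma bounded_shift v B : Defs.bounded_set B -> Defs.bounded_set [set a | B (a - v)].
Proof.
move=> [r Br]; exists (r + `|v|) => a /= /Br /= ar.
by rewrite -[a](subrK v) (le_trans (ler_normD _ _))// lerD2r.
Qed.

Lemma measurable_shift v (B : set R) : measurable (B : set (RL R)) ->
  measurable ([set a | B (a - v)] : set (RL R)).
Proof.
move=> mB; rewrite -[X in measurable X]setTI.
have : measurable_fun [set: RL R] (fun a : RL R => a - v : RL R).
  exact: measurable_funB.
exact.
Qed.

Lemma lebesgue_measure_shift v (B : set R) : measurable (B : set (RL R)) ->
  lebesgue_measure [set a | B (a - v)] = lebesgue_measure B.
Proof.
move=> mB.
have mf : measurable_fun [set: RL R] (fun a : RL R => a - v : RL R).
  exact: measurable_funB.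
pose nu := measure_function_pushforward__canonical__measure_function_Measure
  (@lebesgue_measure R) mf.
apply/esym; apply: (@lebesgue_measure_unique R nu _ B mB) => _ [[a b] /= _ <-].
rewrite /nu/= /pushforward/=.
rewrite (_ : _ @^-1` _ = `]a + v, b + v]%classic); last first.
  by apply/seteqP; split => x /=; rewrite !in_itv/= ltrBrDr lerBlDr.
by rewrite !lebesgue_measure_itv/= !lte_fin ltrD2r -!EFinB opprD addrACA subrr addr0.
Qed.

Lemma measurable_Lshift v : measurable_fun [set: configM R] (Lshift v : configM R -> configM R).
Proof.
apply: (@measurability _ _ (configM R) (configM R) setT (Lshift v) void_sets
  measurable_configM_void) => _ [_ [B [mB bB ->]] <-].
rewrite setTI Lshift_preimage_void measurable_configM_void.
apply: sub_sigma_algebra; exists [set a | B (a - v)]; split => //.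
  exact: measurable_shift.
exact: bounded_shift.
Qed.

Lemma measurable_count_eq B n : measurable (B : set (RL R)) -> Defs.bounded_set B ->
  measurable [set mu : configM R | Defs.count mu B = n].
Proof. by move=> mB bB; apply: sub_sigma_algebra; exists B, n. Qed.

Section Poisson.
Variable P : probability (configM R) R.
Hypothesis poissonP : is_poisson_law P.

Lemma poisson_count (B : set R) n : measurable (B : set (RL R)) -> Defs.bounded_set B ->
  P [set mu : configM R | Defs.count mu B = n] =
  (Defs.poisson_prob (fine (lebesgue_measure B)) n)%:E.
Proof.
move=> mB bB.
have := @poissonP 1 (fun=> B) (fun=> n) (fun=> conj mB bB).
rewrite big_ord1 => <-; last by move=> i j; rewrite !ord1.
congr (P _); apply/seteqP; split => mu /=; first by move=> h i _.
by move=> /(_ ord0); exact.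
Qed.

Lemma lebesgue_measure_bounded_lty (B : set R) : measurable (B : set (RL R)) ->
  Defs.bounded_set B -> (lebesgue_measure B < +oo)%E.
Proof.
move=> mB [r Br].
apply: (@le_lt_trans _ _ (lebesgue_measure (`[- r, r]%classic : set R))).
  apply: le_measure; rewrite ?inE//.
  by move=> x /Br /=; rewrite in_itv/= ler_norml.
rewrite lebesgue_measure_itv/=; case: ifP => _; rewrite ?ltry//.
Qed.

Lemma poisson_void (B : set R) : measurable (B : set (RL R)) -> Defs.bounded_set B ->
  P (void B) = (expR (- fine (lebesgue_measure B)))%:E.
Proof.
move=> mB bB; rewrite -count_eq0// poisson_count// /Defs.poisson_prob.
by rewrite expr0 fact0 divr1 mul1r.
Qed.

Lemma poisson_voidI (B B' : set R) : measurable (B : set (RL R)) -> Defs.bounded_set B ->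
  measurable (B' : set (RL R)) -> Defs.bounded_set B' -> B `&` B' = set0 ->
  P (void B `&` void B') = (P (void B) * P (void B'))%E.
Proof.
move=> mB bB mB' bB' BB'; rewrite voidI !poisson_void//; first last.
- exact: bounded_setU.
- exact: measurableU.
rewrite -EFinM -expRD measureU//= fineD ?ge0_fin_numE ?lebesgue_measure_bounded_lty//.
by rewrite opprD.
Qed.

(** A probability on configurations is determined by its values on void events, and here these
    depend only on Lebesgue measure, which translations preserve. *)
Lemma poisson_Lshift v (E : set (configM R)) : measurable E ->
  P ((Lshift v : configM R -> configM R) @^-1` E) = P E.
Proof.
move=> mE.
pose nu := measure_function_pushforward__canonical__measure_function_Measure
  P (measurable_Lshift v).
apply: (measure_unique void_sets (fun=> setT) measurable_configM_void
   setI_closed_void (fun=> void_sets_setT) _ nu P _ _ E mE).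
- by rewrite bigcup_const.
- move=> _ [B [mB bB ->]]; rewrite /nu/= /pushforward Lshift_preimage_void.
  rewrite !poisson_void ?lebesgue_measure_shift//.
    exact: measurable_shift.
  exact: bounded_shift.
- by move=> k; rewrite /nu/= /pushforward preimage_setT probability_setT ltry.
Qed.

Lemma poisson_void_decorrelation (E F : set (configM R)) :
  void_sets E -> void_sets F ->
  exists K : R, forall v, K < `|v| ->
    P ((Lshift v : configM R -> configM R) @^-1` E `&` F) = (P E * P F)%E.
Proof.
(* A point [a] common to [B'] and to [B] translated by [v] has [|a| <= s] and [|a - v| <= r], which
   forces [|v| <= r + s]. *)
move=> [B [mB [r Br] ->]] [B' [mB' [s Bs] ->]]; exists (r + s) => v rsv.
have bB : Defs.bounded_set B by exists r.
have bB' : Defs.bounded_set B' by exists s.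
rewrite -(poisson_Lshift v (E := void B)); last first.
  rewrite measurable_configM_void; apply: sub_sigma_algebra.
  by exists B.
rewrite Lshift_preimage_void poisson_voidI//.
- exact: measurable_shift.
- exact: bounded_shift.
- apply/seteqP; split => // a /= [/Br/= Ba /Bs/= B'a].
  move: rsv; rewrite ltNge => /negP; apply.
  have -> : v = a - (a - v) by rewrite opprB addrCA subrr addr0.
  by rewrite (le_trans (ler_normB _ _))// addrC lerD.
Qed.

End Poisson.
End Configurations.

(** * The one-dimensional skew product *)

Section UniformMeasure.
Variable R : realType.

Lemma measurable_I01 : measurable (@I01 R).
Proof. exact: measurable_itv. Qed.

Let lamI0 : @lamI R set0 = 0%E.
Proof. by rewrite /lamI set0I measure0. Qed.

Let lamI_ge0 A : (0 <= @lamI R A)%E.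
Proof. exact: measure_ge0. Qed.

Let lamI_sigma_additive : semi_sigma_additive (@lamI R).
Proof. exact: (@measure_semi_sigma_additive _ _ _ (mrestr lebesgue_measure measurable_I01)). Qed.

HB.instance Definition _ := isMeasure.Build _ _ _ (@lamI R)
  lamI0 lamI_ge0 lamI_sigma_additive.

Let lamI_setT : @lamI R setT = 1%E.
Proof.
by rewrite /lamI setTI /I01 lebesgue_measure_itv/= lte_fin ltr01 oppr0 adde0.
Qed.

HB.instance Definition _ := Measure_isProbability.Build _ _ _ (@lamI R) lamI_setT.

End UniformMeasure.

Section Iterates.
Variable R : realType.
Variables S Sinv : RL R -> RL R.
Hypothesis mpS : inv_mp S Sinv.

Let mS : measurable_fun setT S. Proof. by have [] := mpS. Qed.
Let mSinv : measurable_fun setT Sinv. Proof. by have [] := mpS. Qed.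

Lemma measurable_zit k : measurable_fun setT (zit S Sinv k).
Proof.
have mit f n : measurable_fun [set: RL R] f -> measurable_fun [set: RL R] (iter n f).
  move=> mf; elim: n => [|n ih]; first exact: measurable_id.
  exact: (measurableT_comp mf ih).
by case: k => n; exact: mit.
Qed.

Lemma lamI_zit k (A : set (RL R)) : measurable A -> lamI (zit S Sinv k @^-1` A) = lamI A.
Proof.
have [_ _ S01 lamS] := mpS.
have lamSinv B : measurable B -> lamI (Sinv @^-1` B) = lamI B.
  move=> mB; rewrite -lamS; last by rewrite -[X in measurable X]setTI; exact: mSinv.
  rewrite /lamI; congr (lebesgue_measure _); apply/seteqP; split => x /= [Bx xI].
    by have [_ _ e _] := S01 x xI; rewrite e in Bx.
  by have [_ _ e _] := S01 x xI; rewrite e.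
have it f n B : measurable_fun [set: RL R] f ->
    (forall B, measurable B -> lamI (f @^-1` B) = lamI B) ->
    measurable B -> lamI (iter n f @^-1` B) = lamI B.
  move=> mf lf; elim: n B => // n ih B mB.
  have mfB : measurable (f @^-1` B) by rewrite -[X in measurable X]setTI; exact: mf.
  by rewrite -(lf _ mB) -(ih _ mfB).
by move=> mA; case: k => n; exact: it.
Qed.

(** The exponent takes countably many values, and where it is constant the map is a fixed iterate
    after [g]. *)
Lemma measurable_zit_comp d (T : measurableType d) (k : T -> int) (g : T -> RL R) :
  (forall z, measurable (k @^-1` [set z])) -> measurable_fun setT g ->
  measurable_fun setT (fun t => zit S Sinv (k t) (g t)).
Proof.
move=> mk mg _ C mC; rewrite setTI.
rewrite (_ : _ @^-1` _ = \bigcup_(z : int)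
  (k @^-1` [set z] `&` g @^-1` (zit S Sinv z @^-1` C))); last first.
  by apply/seteqP; split => [t Ct|t [z _ [/= <- //]]]; exists (k t).
apply: countable_bigcupT_measurable => // z; apply: measurableI => //.
rewrite -[X in measurable X]setTI; apply: mg => //.
by rewrite -[X in measurable X]setTI; exact: measurable_zit.
Qed.

End Iterates.

(** * Product measures with interleaved factors *)

Section InterleavedProduct.
Local Open Scope ereal_scope.
Context d1 d2 d3 (T1 : measurableType d1) (T2 : measurableType d2)
  (T3 : measurableType d3) (R : realType).
Variables (m1 : probability T1 R) (m2 : probability T2 R) (l : probability T3 R).

(** The factors of [hatP] come in the order mu, nu, x, y, whereas the dynamics couples mu with x and
    nu with y. Tonelli regroups them by integrating out y, then x, then the two configurations. *)
Lemma product_measure_interleave (W1 : set (T1 * T3)) (W2 : set (T2 * T3)) :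
  measurable W1 -> measurable W2 ->
  (((m1 \x m2) \x l) \x l)
    [set o | W1 (o.1.1.1, o.1.2) /\ W2 (o.1.1.2, o.2)] =
  (m1 \x l) W1 * (m2 \x l) W2.
Proof.
move=> mW1 mW2; set U := [set o | _ /\ _].
pose F a := l (xsection W1 a); pose G b := l (xsection W2 b).
have mF : measurable_fun setT F by exact: measurable_fun_xsection.
have mG : measurable_fun setT G by exact: measurable_fun_xsection.
have F0 a : 0 <= F a by exact: measure_ge0.
have G0 b : 0 <= G b by exact: measure_ge0.
pose f (z : T1 * T2 * T3) := (\1_W1 (z.1.1, z.2))%:E * G z.1.2.
have mG2 : measurable_fun [set: T1 * T2] (fun z => G z.2).
  exact: (measurableT_comp mG measurable_snd).
have mf : measurable_fun setT f.
  apply: emeasurable_funM.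
    apply/measurable_EFinP; apply: (measurableT_comp (measurable_indic mW1)).
    apply: measurable_fun_pair => //.
    exact: (measurableT_comp measurable_fst).
  exact: (measurableT_comp mG2 measurable_fst).
have f0 z : 0 <= f z by rewrite mule_ge0// lee_fin.
transitivity (\int[(m1 \x m2) \x l]_z f z).
  apply: eq_integral => z _; rewrite /f indicE /=.
  have [zW|zW] := boolP ((z.1.1, z.2) \in W1).
    rewrite mul1e; congr (l _); apply/seteqP; split => y; rewrite /xsection/= !inE/= /U/=.
      by case.
    by split=> //; exact: set_mem.
  rewrite mul0e (_ : xsection _ _ = set0) ?measure0//.
  apply/seteqP; split => y; rewrite /xsection/= ?inE// /U/= => -[Wz _].
  by move/negP: zW; apply; exact: mem_set.
pose m12 : subprobability (T1 * T2)%type R :=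
  product_subprobability (m1 : subprobability _ _, m2 : subprobability _ _).
apply: (etrans (@fubini_tonelli1 _ _ _ _ _ m12 l f mf f0)).
transitivity (\int[m1 \x m2]_z (F z.1 * G z.2)).
  apply: eq_integral => z _; rewrite /fubini_F /f/=.
  rewrite ge0_integralZr//; last first.
    apply/measurable_EFinP; apply: (measurableT_comp (measurable_indic mW1)).
    exact: measurable_fun_pair.
  congr (_ * _); under eq_integral => x _.
    rewrite (_ : \1_W1 (z.1, x) = \1_(xsection W1 z.1) x); last first.
      by rewrite !indicE mem_xsection.
    over.
  by rewrite integral_indic ?setIT//; exact: measurable_xsection.
pose h (z : T1 * T2) := F z.1 * G z.2.
have h0 z : 0 <= h z by exact: mule_ge0.
have mh : measurable_fun setT h.
  by apply: emeasurable_funM => //; exact: (measurableT_comp mF measurable_fst).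
rewrite (@fubini_tonelli1 _ _ _ _ _ m1 m2 h mh h0) /fubini_F /h/=.
under eq_integral do rewrite ge0_integralZl//.
rewrite ge0_integralZr//.
exact: integral_ge0.
Qed.

End InterleavedProduct.

(** * Correlations of the skew product over Poisson configurations *)

Section Skew.
Variable R : realType.
Variables (P : probability (configM R) R) (S Sinv : RL R -> RL R).
Hypothesis poissonP : is_poisson_law P.
Hypothesis mpS : inv_mp S Sinv.
Implicit Types (v : R) (mu : configM R).

Definition skew v (o : configM R * RL R) : configM R * RL R :=
  (Lshift v o.1, zit S Sinv (scount o.1 v) o.2).

Definition crossed v : set R := if 0 <= v then `]0, v]%classic else `]v, 0]%classic.

Lemma scountE mu v : scount mu v =
  if 0 <= v then (Defs.count mu (crossed v))%:Z else - (Defs.count mu (crossed v))%:Z.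
Proof. by rewrite /scount /crossed; case: ifP. Qed.

Lemma measurable_crossed v : measurable (crossed v : set (RL R)).
Proof. by rewrite /crossed; case: ifP => _; exact: measurable_itv. Qed.

Lemma bounded_crossed v : Defs.bounded_set (crossed v).
Proof.
exists `|v| => x; rewrite /crossed; case: ifP => /= v0; rewrite in_itv/= => /andP[h1 h2].
  by rewrite !ger0_norm// ltW.
rewrite ler0_norm// ler0_norm ?lerN2 1?ltW//.
by rewrite ltNge v0.
Qed.

Lemma lebesgue_crossed v : fine (lebesgue_measure (crossed v)) = `|v|.
Proof.
rewrite /crossed; have [v0|v0] := leP 0 v; rewrite lebesgue_measure_itv/= lte_fin.
  move: v0; rewrite le_eqVlt => /predU1P[<-|v0]; first by rewrite ltxx normr0.
  by rewrite v0/= oppr0 addr0 gtr0_norm.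
by rewrite v0/= add0r ltr0_norm.
Qed.

Lemma measurable_scount v z : measurable ((fun mu : configM R => scount mu v) @^-1` [set z]).
Proof.
pose e (n : nat) : int := if 0 <= v then n%:Z else - n%:Z.
rewrite (_ : _ @^-1` _ = \bigcup_(n in [set n | e n = z])
    [set mu : configM R | Defs.count mu (crossed v) = n]); last first.
  apply/seteqP; split => mu /=; rewrite scountE.
    by move=> h; exists (Defs.count mu (crossed v)) => //=; rewrite -h /e; case: ifP.
  by move=> [n /= <- ->]; rewrite /e; case: ifP.
apply: bigcup_measurable => n _; apply: measurable_count_eq.
  exact: measurable_crossed.
exact: bounded_crossed.
Qed.

Lemma measurable_skew v : measurable_fun setT (skew v).
Proof.
apply: measurable_fun_pair.
  exact: (measurableT_comp (measurable_Lshift v) measurable_fst).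
apply: measurable_zit_comp => // z.
rewrite (_ : _ @^-1` _ = fst @^-1` ((fun mu : configM R => scount mu v) @^-1` [set z]))//.
rewrite -[X in measurable X]setTI; apply: measurable_fst => //.
exact: measurable_scount.
Qed.

Definition overlap (C D : set (RL R)) (k : int) : R :=
  fine (lamI (zit S Sinv k @^-1` C `&` D)).

Lemma overlap_ge0 C D k : 0 <= overlap C D k.
Proof. by rewrite fine_ge0. Qed.

Lemma lamI_overlap C D k : measurable C -> measurable D ->
  lamI (zit S Sinv k @^-1` C `&` D) = (overlap C D k)%:E.
Proof.
move=> mC mD; rewrite fineK// fin_num_measure//; apply: measurableI => //.
by rewrite -[X in measurable X]setTI; exact: measurable_zit.
Qed.

(** The point x is integrated out first: over a fixed [mu] the exponent is constant, so the fibre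
    has measure [overlap] or 0. *)
Lemma skew_rect v (E F : set (configM R)) (C D : set (RL R)) :
  measurable C -> measurable D ->
  (P \x @lamI R)%E (skew v @^-1` (E `*` C) `&` (F `*` D)) =
  (\int[P]_mu (\1_((Lshift v : configM R -> configM R) @^-1` E `&` F) mu
     * overlap C D (scount mu v))%:E)%E.
Proof.
move=> mC mD; apply: eq_integral => mu _; rewrite indicE.
have [|] := boolP (mu \in _) => muG /=.
  rewrite mul1r -lamI_overlap//; congr (lamI _).
  have [/= Emu Fmu] := set_mem muG.
  apply/seteqP; split => x; rewrite /xsection/= inE /skew/=.
    by move=> [[_ Cx] [_ Dx]].
  by move=> [Cx Dx]; split; split.
rewrite mul0r (_ : xsection _ _ = set0) ?measure0//.
apply/seteqP; split => x //; rewrite /xsection/= inE => -[[/= Emu _] [/= Fmu _]].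
by move/negP: muG; apply; exact: mem_set.
Qed.

Lemma measurable_scount_comp v (g : int -> R) :
  measurable_fun [set: configM R] (fun mu : configM R => g (scount mu v)).
Proof.
move=> _ B mB; rewrite setTI.
rewrite (_ : _ @^-1` _ = \bigcup_(z in [set z | B (g z)])
    ((fun mu : configM R => scount mu v) @^-1` [set z])); last first.
  apply/seteqP; split => [mu Bmu|mu [z /= Bz zE]]; first by exists (scount mu v).
  by rewrite zE.
rewrite bigcup_mkcond; apply: countable_bigcupT_measurable => // z.
by case: ifP => _ //; exact: measurable_scount.
Qed.

Lemma measurable_preimage_Lshift v (E : set (configM R)) : measurable E ->
  measurable ((Lshift v : configM R -> configM R) @^-1` E).
Proof. by move=> mE; rewrite -[X in measurable X]setTI; exact: measurable_Lshift. Qed.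

Lemma measurable_preimage_skew v (A : set (configM R * RL R)) : measurable A ->
  measurable (skew v @^-1` A).
Proof. by move=> mA; rewrite -[X in measurable X]setTI; exact: measurable_skew. Qed.

(** On rectangles the fibre measure is [lamI C] whatever the exponent, so the integral factors and
    invariance of [P] under [Lshift] concludes. *)
Lemma skew_preserving v (A : set (configM R * RL R)) : measurable A ->
  (P \x @lamI R)%E (skew v @^-1` A) = (P \x @lamI R)%E A.
Proof.
move=> mA.
pose nu := measure_function_pushforward__canonical__measure_function_Measure
  (P \x @lamI R)%E (measurable_skew v).
apply/esym; apply: (@product_measure_unique _ _ _ _ _ P (@lamI R) nu _ A mA) => E C mE mC.
rewrite /nu/= /pushforward -[_ @^-1` _]setIT -setXTT skew_rect//.
under eq_integral => mu _.
  rewrite setIT /overlap setIT (lamI_zit mpS)// EFinM fineK ?fin_num_measure//.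
  over.
rewrite ge0_integralZr//.
- rewrite integral_indic ?setIT//; last exact: measurable_preimage_Lshift.
  by congr (_ * _)%E; exact: (poisson_Lshift poissonP).
- apply/measurable_EFinP; apply: measurable_indic; exact: measurable_preimage_Lshift.
Qed.

Definition overlap_defect (C D : set (RL R)) (k : int) : R :=
  `|overlap C D k - fine (lamI C) * fine (lamI D)|.

(** A count of n gives the exponent n or -n according to the sign of [v]; adding both defects yields
    one sequence that bounds either case. *)
Definition sym_overlap_defect (C D : set (RL R)) (n : nat) : R :=
  overlap_defect C D n%:Z + overlap_defect C D (- n%:Z).

Lemma sym_overlap_defect_ge0 C D n : 0 <= sym_overlap_defect C D n.
Proof. by rewrite addr_ge0// normr_ge0. Qed.

(** The integral is split over the value of the count on [crossed v], a Poisson variable of mean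
    [|v|]. *)
Lemma integral_overlap_defect_le v C D :
  (\int[P]_mu (overlap_defect C D (scount mu v))%:E <=
   poisson_average (sym_overlap_defect C D) v)%E.
Proof.
pose N (mu : configM R) := Defs.count mu (crossed v).
have mN n : measurable [set mu : configM R | N mu = n].
  by apply: measurable_count_eq; [exact: measurable_crossed|exact: bounded_crossed].
pose f n (mu : configM R) : \bar R :=
  (sym_overlap_defect C D n * \1_[set mu : configM R | N mu = n] mu)%:E.
have f0 n mu : (0 <= f n mu)%E.
  by rewrite lee_fin mulr_ge0// sym_overlap_defect_ge0.
have mf n : measurable_fun setT (f n).
  by apply/measurable_EFinP; apply: measurable_funM => //; exact: measurable_indic.
apply: (@le_trans _ _ (\int[P]_mu \sum_(n <oo) f n mu)%E).
  apply: ge0_le_integral => //.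
  - by move=> mu _; rewrite lee_fin normr_ge0.
  - by apply/measurable_EFinP; exact: measurable_scount_comp.
  - by apply: ge0_emeasurable_sum => // n mu _ _; exact: f0.
  - move=> mu _; rewrite (nneseriesD1 (n := N mu))//.
    apply: (@le_trans _ _ (f (N mu) mu)); last first.
      by rewrite leeDl//; apply: nneseries_ge0 => n _ _; exact: f0.
    rewrite /f indicE mem_set// mulr1 lee_fin scountE /sym_overlap_defect.
    by case: ifP => _; [rewrite lerDl|rewrite lerDr]; exact: normr_ge0.
rewrite integral_nneseries//.
rewrite /poisson_average; apply: lee_nneseries => [n _ _|n _]; first exact: integral_ge0.
rewrite /f; under eq_integral do rewrite EFinM.
rewrite ge0_integralZl//; first last.
- by rewrite lee_fin sym_overlap_defect_ge0.
- by apply/measurable_EFinP; exact: measurable_indic.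
rewrite integral_indic// setIT EFinM -(lebesgue_crossed v).
rewrite -(poisson_count poissonP)//; first exact: measurable_crossed.
exact: bounded_crossed.
Qed.

Lemma fine_lamI_le1 (C : set (RL R)) : measurable C -> 0 <= fine (lamI C) <= 1.
Proof.
move=> mC; rewrite fine_ge0//= -lee_fin fineK ?fin_num_measure//.
exact: probability_le1.
Qed.

(** Replacing the overlap by its limit value [c] costs the expected defect. Then [P G] factors
    exactly once [|v|] exceeds [K]; for smaller [|v|] the numbers [c * P G] and [c * (P E * P F)]
    both lie in [0, 1], and the indicator pays for their distance. *)
Lemma skew_rect_decorrelation (E F : set (configM R)) (C D : set (RL R)) :
  void_sets E -> void_sets F -> measurable C -> measurable D ->
  exists K : R, forall v,
    (`|(P \x @lamI R) (skew v @^-1` (E `*` C) `&` (F `*` D))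
       - (P \x @lamI R) (E `*` C) * (P \x @lamI R) (F `*` D)|
     <= (\1_[set x : R | (`|x| <= K)%R] v)%:E
        + poisson_average (sym_overlap_defect C D) v)%E.
Proof.
move=> vE vF mC mD.
have mv G : void_sets G -> measurable (G : set (configM R)).
  by move=> vG; rewrite measurable_configM_void; exact: sub_sigma_algebra.
have [mE mF] := (mv _ vE, mv _ vF).
have [K HK] := poisson_void_decorrelation poissonP vE vF.
exists K => v.
set G := (Lshift v : configM R -> configM R) @^-1` E `&` F.
have mG : measurable G by apply: measurableI => //; exact: measurable_preimage_Lshift.
rewrite skew_rect// !product_measure1E//.
pose c := fine (lamI C) * fine (lamI D).
have /andP[C0 C1] := fine_lamI_le1 mC.
have /andP[D0 D1] := fine_lamI_le1 mD.
have c0 : 0 <= c by exact: mulr_ge0.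
have c1 : c <= 1 by rewrite -[1]mulr1; exact: ler_pM.
have ovl1 k : overlap C D k <= 1.
  apply: (@le_trans _ _ (fine (lamI D))) => //; apply: fine_le.
  - by rewrite fin_num_measure//; apply: measurableI => //;
      rewrite -[X in measurable X]setTI; exact: measurable_zit.
  - by rewrite fin_num_measure.
  - apply: le_measure; rewrite ?inE//.
    by apply: measurableI => //; rewrite -[X in measurable X]setTI; exact: measurable_zit.
pose f (mu : configM R) : R := \1_G mu * overlap C D (scount mu v).
pose g (mu : configM R) : R := overlap_defect C D (scount mu v).
have mf : measurable_fun setT (EFin \o f).
  apply/measurable_EFinP; apply: measurable_funM; first exact: measurable_indic.
  exact: measurable_scount_comp.
have mg : measurable_fun setT (EFin \o g).
  by apply/measurable_EFinP; exact: measurable_scount_comp.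
have f0 mu : 0 <= f mu by rewrite mulr_ge0// overlap_ge0.
have g0 mu : 0 <= g mu by rewrite normr_ge0.
have m1 : measurable_fun setT (fun mu => (c * \1_G mu)%:E : \bar R).
  by apply/measurable_EFinP; apply: measurable_funM => //; exact: measurable_indic.
have i1 : (\int[P]_mu (c * \1_G mu)%:E)%E = (c%:E * P G)%E.
  under eq_integral do rewrite EFinM.
  rewrite ge0_integralZl//.
  - by rewrite integral_indic// setIT.
  - by apply/measurable_EFinP; exact: measurable_indic.
(* [upper] and [lower] integrate the pointwise bound of [|f - c * \1_G|] by [g]; two one-sided
   inequalities avoid subtracting extended reals. *)
have upper : (\int[P]_mu (f mu)%:E <= c%:E * P G + \int[P]_mu (g mu)%:E)%E.
  rewrite -i1 -ge0_integralD//; last 2 first.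
  - by move=> x _; rewrite lee_fin mulr_ge0.
  - by move=> x _; rewrite lee_fin.
  apply: ge0_le_integral => //.
  - by move=> x _; rewrite lee_fin.
  - exact: emeasurable_funD.
  - move=> mu _; rewrite -EFinD lee_fin /f /g /overlap_defect -/c indicE.
    have := normr_ge0 (overlap C D (scount mu v) - c).
    have := ler_norm (overlap C D (scount mu v) - c).
    by case: (mu \in G) => /=; rewrite ?mul1r ?mul0r ?mulr1 ?mulr0; lra.
have lower : (c%:E * P G <= \int[P]_mu (f mu)%:E + \int[P]_mu (g mu)%:E)%E.
  rewrite -i1 -ge0_integralD//; last 2 first.
  - by move=> x _; rewrite lee_fin.
  - by move=> x _; rewrite lee_fin.
  apply: ge0_le_integral => //.
  - by move=> x _; rewrite lee_fin mulr_ge0.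
  - exact: emeasurable_funD.
  - move=> mu _; rewrite -EFinD lee_fin /f /g /overlap_defect -/c indicE.
    have := normr_ge0 (overlap C D (scount mu v) - c).
    have := lerNnormlW (lexx `|overlap C D (scount mu v) - c|).
    by case: (mu \in G) => /=; rewrite ?mul1r ?mul0r ?mulr1 ?mulr0; lra.
have bound h (k : R) : measurable_fun setT (EFin \o h) -> (forall mu, 0 <= h mu) ->
    (forall mu, h mu <= k) -> (\int[P]_mu (h mu)%:E)%E \is a fin_num.
  move=> mh h0 hk; rewrite ge0_fin_numE; last by apply: integral_ge0 => x _; rewrite lee_fin.
  apply: (@le_lt_trans _ _ (\int[P]_mu (cst k%:E mu))%E).
    by apply: ge0_le_integral => // x _; rewrite lee_fin.
  by rewrite integral_cst//= probability_setT mule1 ltry.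
have fa := bound f 1 mf f0.
have {}fa : (\int[P]_mu (f mu)%:E)%E \is a fin_num.
  apply: fa => mu; rewrite /f indicE; case: (mu \in G) => /=; rewrite ?mul1r ?mul0r//.
have fb : (\int[P]_mu (g mu)%:E)%E \is a fin_num.
  apply: (bound g 1 mg g0) => mu.
  have := ovl1 (scount mu v); have := overlap_ge0 C D (scount mu v).
  by rewrite /g /overlap_defect -/c ler_norml; lra.
have fG := fin_num_measure P _ mG.
have fE := fin_num_measure P _ mE.
have fF := fin_num_measure P _ mF.
have fC := fin_num_measure (@lamI R) _ mC.
have fD := fin_num_measure (@lamI R) _ mD.
have : (`|\int[P]_mu (f mu)%:E - P E * lamI C * (P F * lamI D)| <=
    (\1_[set x : R | (`|x| <= K)%R] v)%:E + \int[P]_mu (g mu)%:E)%E.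
  have PG1 := probability_le1 P mG.
  have PE1 := probability_le1 P mE.
  have PF1 := probability_le1 P mF.
  have HK' : (K < `|v|)%R -> P G = (P E * P F)%E by exact: HK.
  move: upper lower HK' PG1 PE1 PF1.
  rewrite -(fineK fa) -(fineK fb) -(fineK fG) -(fineK fE) -(fineK fF) -(fineK fC) -(fineK fD).
  rewrite -!EFinM -!EFinD !lee_fin.
  set a := fine _; set pG := fine _; set b := fine _; set pE := fine _; set pF := fine _.
  move=> up lo HKv pG1 pE1 pF1.
  have pG0 : 0 <= pG by rewrite fine_ge0.
  have pE0 : 0 <= pE by rewrite fine_ge0.
  have pF0 : 0 <= pF by rewrite fine_ge0.
  have -> : pE * fine (lamI C) * (pF * fine (lamI D)) = c * (pE * pF).
    by rewrite /c; ring.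
  have pEF0 : 0 <= pE * pF by exact: mulr_ge0.
  have pEF1 : pE * pF <= 1 by rewrite -[1]mulr1; exact: ler_pM.
  rewrite indicE; have [Kv|vK] := ltP K `|v|.
    rewrite memNset/= ?add0r; last by rewrite leNgt Kv.
    have [pGE] := HKv Kv; rewrite -pGE.
    by rewrite ler_norml; lra.
  rewrite mem_set//=.
  have h1 : c * (pE * pF) <= 1 by rewrite -[1]mulr1; exact: ler_pM.
  have h2 : c * pG <= 1 by rewrite -[1]mulr1; exact: ler_pM.
  have h3 : 0 <= c * (pE * pF) by exact: mulr_ge0.
  have h4 : 0 <= c * pG by exact: mulr_ge0.
  by rewrite ler_norml; lra.
move=> /le_trans; apply; rewrite leeD2l//.
exact: integral_overlap_defect_le.
Qed.

(** Cesaro convergence is recast as a linear bound valid for every [N], the form that summation by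
    parts consumes; the constant covers the finitely many [N] before the averages become small. *)
Lemma sum_overlap_defect_le C D eps : weakly_mixing_Z (@lamI R) S Sinv ->
  measurable C -> measurable D -> 0 < eps ->
  exists2 c, 0 <= c & forall N : nat,
    \sum_(n < N) sym_overlap_defect C D n <= eps * N%:R + c.
Proof.
move=> wm mC mD e0.
pose d := overlap_defect C D.
have d0 k : 0 <= d k by exact: normr_ge0.
pose A N : R := \sum_(i < (2 * N).+1) d (i%:Z - N%:Z).
(* The symmetrised sum counts the exponent 0 twice while the window from -N to N contains it once,
   so each half is compared separately with all of [A N]. *)
have A_right N : \sum_(n < N) d n%:Z <= A N.
  rewrite /A -(big_mkord xpredT (fun i => d (i%:Z - N%:Z))).
  rewrite (@big_cat_nat _ _ _ N)//=; last by rewrite mul2n -addnn -addSn leq_addl.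
  rewrite -[X in _ <= _ + \sum_(X <= i < _) _]add0n big_addn.
  rewrite (_ : ((2 * N).+1 - N)%N = N.+1); last first.
    by rewrite mul2n -addnn -addSn addnK.
  rewrite big_nat_recr//= -(big_mkord xpredT (fun i => d i%:Z)).
  rewrite [X in _ <= _ + (X + _)](eq_bigr (fun i => d i%:Z)); last first.
    by move=> i _; rewrite PoszD addrK.
  rewrite addrA addrAC lerDr addr_ge0//; exact: sumr_ge0.
have A_left N : \sum_(n < N) d (- n%:Z) <= A N.
  rewrite /A -(big_mkord xpredT (fun i => d (i%:Z - N%:Z))).
  rewrite (@big_cat_nat _ _ _ N.+1)//=; last by rewrite ltnS mul2n -addnn leq_addl.
  rewrite big_nat_rev/= add0n big_nat_recr//= -(big_mkord xpredT (fun i => d (- i%:Z))).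
  rewrite [X in _ <= X + _ + _](eq_big_nat _ _ (F2 := fun i => d (- i%:Z))); last first.
    move=> i /andP[_ iN]; rewrite subSS -subzn ?(ltnW iN)//.
    by rewrite addrAC subrr add0r.
  rewrite -addrA lerDl addr_ge0//; exact: sumr_ge0.
pose X N : R := (2 * N%:R)^-1 * A N.
have : X @ \oo --> 0.
  have /fine_cvgP[_] := wm C D mC mD.
  apply: cvg_trans; apply: near_eq_cvg; apply: nearW => N /=.
  rewrite (eq_bigr (fun i : 'I_(2 * N).+1 => (d (i%:Z - N%:Z))%:E)).
    by rewrite sumEFin.
  move=> i _; rewrite lamI_overlap//.
  rewrite -(fineK (fin_num_measure (@lamI R) _ mC)) -(fineK (fin_num_measure (@lamI R) _ mD)).
  by [].
(* An average of at most [eps / 4] gives [A N <= eps * N / 2], and [A N] is used once for each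
   half. *)
move=> /cvgrPdist_le /(_ (eps / 4)) [|N0 _ HN0]; first by rewrite divr_gt0.
exists (\sum_(n < N0) sym_overlap_defect C D n).
  by apply: sumr_ge0 => n _; exact: sym_overlap_defect_ge0.
move=> N; have [NN0|N0N] := ltnP N N0.
  apply: ler_wpDl; first by rewrite mulr_ge0// ltW.
  rewrite -!(big_mkord xpredT (sym_overlap_defect C D)).
  rewrite (@big_cat_nat _ _ _ N 0 N0)//= ?(ltnW NN0)// lerDl.
  by apply: sumr_ge0 => n _; exact: sym_overlap_defect_ge0.
apply: ler_wpDr; first by apply: sumr_ge0 => n _; exact: sym_overlap_defect_ge0.
have [->|N_gt0] := posnP N; first by rewrite big_ord0 mulr0.
have := HN0 N N0N; rewrite sub0r normrN.
move=> /(le_trans (ler_norm _)); rewrite /X mulrC ler_pdivrMr; last first.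
  by rewrite mulr_gt0// ltr0n.
have := A_right N; have := A_left N.
rewrite /sym_overlap_defect big_split/= -/d; lra.
Qed.

End Skew.

(** * Two-dimensional averages and Dynkin classes *)

Section Averages.
Variable R : realType.
Local Notation mu := (@lebesgue_measure R).

(** The integral of [h] over [[-r, r]] is o(r); writing the bound as [e * r] avoids dividing
    extended reals. *)
Definition cesaro_null (h : R -> \bar R) :=
  [/\ measurable_fun [set: R] h, (forall x, 0 <= h x)%E &
    forall e : R, 0 < e -> \forall r \near +oo,
      (\int[mu]_(x in `[(- r)%R, r]) h x <= (e * r)%:E)%E].

Lemma cesaro_nullD h1 h2 : cesaro_null h1 -> cesaro_null h2 ->
  cesaro_null (fun x => (h1 x + h2 x)%E).
Proof.
move=> [m1 p1 c1] [m2 p2 c2]; split.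
- exact: emeasurable_funD.
- by move=> x; exact: adde_ge0.
- move=> e e0; have e2 : 0 < e / 2 by rewrite divr_gt0.
  near=> r; rewrite ge0_integralD//; try exact: measurable_funTS.
  rewrite (splitr e) mulrDl EFinD leeD//; near: r; [exact: c1|exact: c2].
Unshelve. all: by end_near. Qed.

Lemma cesaro_null_indic (K : R) :
  cesaro_null (fun v => (\1_[set x : R | `|x| <= K] v)%:E).
Proof.
have E : [set x : R | `|x| <= K] = `[- K, K]%classic.
  by apply/seteqP; split => x /=; rewrite in_itv/= ler_norml.
rewrite E; split.
- by apply/measurable_EFinP; exact: measurable_indic.
- by move=> x; rewrite lee_fin.
- move=> e e0; near=> r; rewrite integral_indic//=.
  apply: (@le_trans _ _ (mu (`[- K, K]%classic : set R))).
    by apply: le_measure; rewrite ?inE//; exact: measurableI.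
  rewrite lebesgue_measure_itv/=.
  apply: (@le_trans _ _ (`|K| + `|K|)%:E).
    case: ifP => _; rewrite lee_fin; last by rewrite addr_ge0.
    by rewrite opprK lerD// ler_norm.
  rewrite lee_fin mulrC -ler_pdivrMr//; by near: r; apply: nbhs_pinfty_ge; exact: num_real.
Unshelve. all: by end_near. Qed.

Lemma cesaro_null_poisson_average (theta : nat -> R) : (forall n, 0 <= theta n) ->
  (forall eps, 0 < eps -> exists2 c, 0 <= c &
     forall N, \sum_(n < N) theta n <= eps * N%:R + c) ->
  cesaro_null (poisson_average theta).
Proof.
move=> theta0 thetaN; split.
- exact: measurable_poisson_average.
- move=> x; apply: nneseries_ge0 => n _ _.
  by rewrite lee_fin mulr_ge0// poisson_prob_ge0.
(* With [e / 4] the integral bound reads [2 * c + e * r / 2], which is at most [e * r] as soon as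
   [4 * c / e <= r]. *)
- move=> e e0; have [|c c0 cN] := thetaN (e / 4); first by rewrite divr_gt0.
  near=> r.
  apply: (le_trans (integral_poisson_average_le theta0 _ c0 _ cN)).
  + by rewrite divr_ge0// ltW.
  + near: r; apply: nbhs_pinfty_ge; exact: num_real.
  + rewrite lee_fin.
    have : 4 * c / e <= r by near: r; apply: nbhs_pinfty_ge; exact: num_real.
    by rewrite ler_pdivrMr// => ?; lra.
Unshelve. all: by end_near. Qed.

(* Domination by one-variable functions makes the two-dimensional average of F
   vanish without requiring F to be measurable. *)
Definition cesaro_dominated (F : R -> R -> \bar R) :=
  forall e : R, 0 < e -> exists h1 h2, [/\ cesaro_null h1, cesaro_null h2 &
    forall v w, (F v w <= e%:E + (h1 v + h2 w))%E].

Lemma le_cesaro_dominated F G : (forall v w, (F v w <= G v w)%E) ->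
  cesaro_dominated G -> cesaro_dominated F.
Proof.
move=> FG dG e /dG[h1 [h2 [c1 c2 h]]]; exists h1, h2; split => // v w.
exact: (le_trans (FG v w)).
Qed.

Lemma cesaro_dominatedD F G : cesaro_dominated F -> cesaro_dominated G ->
  cesaro_dominated (fun v w => (F v w + G v w)%E).
Proof.
move=> dF dG e e0; have e2 : 0 < e / 2 by rewrite divr_gt0.
have [f1 [f2 [c1 c2 Ff]]] := dF _ e2.
have [g1 [g2 [d1 d2 Gg]]] := dG _ e2.
exists (fun x => f1 x + g1 x)%E, (fun x => f2 x + g2 x)%E; split.
- exact: cesaro_nullD.
- exact: cesaro_nullD.
- move=> v w; apply: (le_trans (leeD (Ff v w) (Gg v w))).
  by rewrite [in leRHS](splitr e) EFinD addeACA (addeACA (f1 v)).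
Qed.

(** The integral of a nonnegative function is a supremum over the simple functions below it, hence
    monotone even for functions that are not measurable. *)
Lemma ge0_le_lower_integral d (T : measurableType d) (m : {measure set T -> \bar R})
    (D : set T) (f g : T -> \bar R) :
  (forall x, D x -> 0 <= f x)%E -> (forall x, D x -> f x <= g x)%E ->
  (\int[m]_(x in D) f x <= \int[m]_(x in D) g x)%E.
Proof.
move=> f0 fg; rewrite !(integral_mkcond D) !ge0_integralTE.
- apply: le_ereal_sup => _ [h hf <-]; exists h => // x.
  by apply: (le_trans (hf x)); rewrite /patch; case: ifPn => // /set_mem; exact: fg.
- by move=> x; apply: erestrict_ge0 => y Dy; exact: le_trans (f0 _ Dy) (fg _ Dy).
- by move=> x; exact: erestrict_ge0.
Qed.

Lemma ge0_cvge0 (X : R -> \bar R) : (forall r, 0 <= X r)%E ->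
  (forall e : R, 0 < e -> \forall r \near +oo, (X r <= e%:E)%E) ->
  X @ +oo --> 0%E.
Proof.
move=> X0 Xe.
have Xfin : \forall r \near +oo, X r \is a fin_num.
  near=> r; rewrite ge0_fin_numE//; apply: (@le_lt_trans _ _ 1%:E); last exact: ltry.
  near: r; exact: Xe.
apply/fine_cvgP; split => //; apply/cvgrPdist_le => e e0.
near=> r; rewrite sub0r normrN ger0_norm ?fine_ge0//.
rewrite -lee_fin fineK; first by near: r; exact: Xe.
near: r; exact: Xfin.
Unshelve. all: by end_near. Qed.

Lemma boxE (r : R) : box r = `[- r, r]%classic `*` `[- r, r]%classic.
Proof.
by apply/seteqP; split => -[x y]; rewrite /box/= !in_itv/= !ler_norml.
Qed.

Lemma integral_box (r : R) (f : R * R -> \bar R) : measurable_fun [set: R * R] f ->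
  (forall z, 0 <= f z)%E ->
  (\int[(mu \x mu)%E]_(z in box r) f z =
   \int[mu]_(v in `[(- r)%R, r]) \int[mu]_(w in `[(- r)%R, r]) f (v, w))%E.
Proof.
move=> mf f0; set I := `[(- r)%R, r]%classic.
have mI : measurable (I : set R) by exact: measurable_itv.
have mbox : measurable (box r : set (R * R)) by rewrite boxE; exact: measurableX.
rewrite integral_mkcond fubini_tonelli1.
- rewrite [RHS]integral_mkcond; apply: eq_integral => v _.
  rewrite /fubini_F /patch; case: ifPn => vI.
    rewrite [RHS]integral_mkcond; apply: eq_integral => w _; rewrite /patch boxE.
    rewrite in_setX/= vI/=; by [].
  apply: integral0_eq => w _; rewrite boxE in_setX/= (negbTE vI).
  by [].
- apply/(measurable_restrictT _ _).1 => //; exact: measurable_funTS.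
- by move=> z; apply: erestrict_ge0.
Qed.

Lemma cesaro_dominated_cvg (F : R -> R -> \bar R) : (forall v w, 0 <= F v w)%E ->
  cesaro_dominated F ->
  (fun r : R => ((2 * r) ^- 2)%:E *
     \int[(mu \x mu)%E]_(g in box r) F g.1 g.2)%E @ +oo%R --> 0%E.
Proof.
move=> F0 dF; apply: ge0_cvge0 => [r|e e0].
  rewrite mule_ge0//; first by rewrite lee_fin invr_ge0 sqr_ge0.
  exact: integral_ge0.
have e2 : 0 < e / 2 by rewrite divr_gt0.
have [h1 [h2 [[m1 p1 c1] [m2 p2 c2] Fh]]] := dF _ e2.
near=> r.
have r0 : 0 < r by near: r; exact: nbhs_pinfty_gt.
have I1 : (\int[mu]_(x in `[(- r)%R, r]) h1 x <= (e / 2 * r)%:E)%E by near: r; exact: c1.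
have I2 : (\int[mu]_(x in `[(- r)%R, r]) h2 x <= (e / 2 * r)%:E)%E by near: r; exact: c2.
set I := `[(- r)%R, r]%classic.
have mI : measurable (I : set R) by exact: measurable_itv.
have muI : mu I = (2 * r)%:E.
  rewrite /I lebesgue_measure_itv/= lte_fin gtrN// -EFinD opprK.
  by rewrite mulr_natl mulr2n.
pose H (g : R * R) : \bar R := ((e / 2)%:E + (h1 g.1 + h2 g.2))%E.
have H0 g : (0 <= H g)%E.
  by rewrite !adde_ge0// lee_fin ltW.
have mH : measurable_fun [set: R * R] H.
  apply: emeasurable_funD => //; apply: emeasurable_funD.
    exact: (measurableT_comp m1 measurable_fst).
  exact: (measurableT_comp m2 measurable_snd).
have : (\int[(mu \x mu)%E]_(g in box r) F g.1 g.2 <=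
    \int[(mu \x mu)%E]_(g in box r) H g)%E.
  by apply: ge0_le_lower_integral => g _; [exact: F0|exact: Fh].
rewrite (integral_box r mH H0) => FH.
have inner v : (\int[mu]_(w in I) H (v, w) <= (e * r + e / 2 * r)%:E + h1 v * (2 * r)%:E)%E.
  rewrite /H/= ge0_integralD//; first last.
  - by apply: emeasurable_funD => //; exact: measurable_funTS.
  - by move=> w _; exact: adde_ge0.
  - by move=> w _; rewrite lee_fin ltW.
  rewrite integral_cst//= muI ge0_integralD//; last exact: measurable_funTS.
  rewrite integral_cst//= muI addeCA [leRHS]addeC leeD2l// -EFinM EFinD.
  apply: leeD => //; rewrite lee_fin; lra.
(* The constant [e / 2] over a box of area [4 * r ^+ 2] contributes [2 * e * r ^+ 2]; each of [h1]
   and [h2] contributes at most [e / 2 * r] times the side [2 * r]. *)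
have outer : (\int[mu]_(v in I) \int[mu]_(w in I) H (v, w) <= (4 * e * r ^+ 2)%:E)%E.
  apply: (@le_trans _ _ (\int[mu]_(v in I) ((e * r + e / 2 * r)%:E + h1 v * (2 * r)%:E))%E).
    apply: ge0_le_lower_integral => v _ //; exact: integral_ge0.
  rewrite ge0_integralD//; first last.
  - by apply: emeasurable_funM => //; exact: measurable_funTS.
  - by move=> v _; rewrite mule_ge0// lee_fin mulr_ge0// ltW.
  - by move=> v _; rewrite lee_fin addr_ge0// mulr_ge0 ?divr_ge0// ltW.
  rewrite integral_cst//= muI ge0_integralZr//; first last.
  - by rewrite lee_fin mulr_ge0// ltW.
  - exact: measurable_funTS.
  apply: (@le_trans _ _ ((e * r + e / 2 * r)%:E * (2 * r)%:E + (e / 2 * r)%:E * (2 * r)%:E)%E).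
    by rewrite leeD2l// lee_wpmul2r// lee_fin mulr_ge0// ltW.
  by rewrite -!EFinM -EFinD lee_fin expr2; lra.
apply: (@le_trans _ _ (((2 * r) ^- 2)%:E * (4 * e * r ^+ 2)%:E)%E).
  by rewrite lee_pmul2l// ?lte_fin ?invr_gt0 ?exprn_gt0 ?mulr_gt0// (le_trans FH).
rewrite -EFinM lee_fin.
have -> : (2 * r) ^- 2 * (4 * e * r ^+ 2) = e by field; rewrite gt_eqF.
exact: lexx.
Unshelve. all: by end_near. Qed.

End Averages.

(** * Dynkin classes of events with dominated defects *)

Section LambdaSystem.
Context d (T : measurableType d) (R : realType).
Variable m : {measure set T -> \bar R}.
Hypothesis m_fin : (m setT < +oo)%E.

Lemma fin_num_of_finite A : measurable A -> m A \is a fin_num.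
Proof.
move=> mA; rewrite ge0_fin_numE//; apply: le_lt_trans m_fin.
by apply: le_measure; rewrite ?inE.
Qed.

Lemma fine_measureD A B : measurable A -> measurable B -> B `<=` A ->
  fine (m (A `\` B)) = fine (m A) - fine (m B).
Proof.
move=> mA mB BA; rewrite measureD//= ?fineB ?fin_num_of_finite//.
  by rewrite setIidr.
  exact: measurableI.
by rewrite -ge0_fin_numE ?fin_num_of_finite.
Qed.

Variables (nu : R -> R -> set T -> R) (c : R).
Hypothesis c01 : 0 <= c <= 1.
Hypothesis nuD : forall v w A B, measurable A -> measurable B -> B `<=` A ->
  nu v w (A `\` B) = nu v w A - nu v w B.
Hypothesis nu_le : forall v w A, measurable A -> 0 <= nu v w A <= fine (m A).

Let defect A v w : \bar R := (`|nu v w A - fine (m A) * c|)%:E.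

(** The abstract [nu] stands for the correlation as a function of one of its two events, and [c] for
    the measure of the other, so that both events can be treated. For an increasing union, [nu_le]
    applied to [A] minus [F n] makes the approximation error uniform in [v] and [w]. *)
Lemma cesaro_dominated_lambda_system : cesaro_dominated (defect setT) ->
  lambda_system setT [set A | measurable A /\ cesaro_dominated (defect A)].
Proof.
move=> dT; split => //.
- move=> A B BA [mA dA] [mB dB]; split; first exact: measurableD.
  apply: le_cesaro_dominated (cesaro_dominatedD dA dB) => v w.
  rewrite /defect -EFinD lee_fin nuD// fine_measureD//.
  rewrite (_ : nu v w A - nu v w B - _ = (nu v w A - fine (m A) * c) -
    (nu v w B - fine (m B) * c)); last by ring.
  exact: ler_normB.
- move=> F ndF FG; set A := \bigcup_k F k.
  have mF n : measurable (F n) by have [] := FG n.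
  have mA : measurable A by exact: bigcup_measurable.
  split => // e e0.
  have /fine_cvgP[_ /cvgrPdist_le /(_ (e / 4))] :
      (m \o F) x @[x --> \oo] --> (fine (m A))%:E.
    by rewrite fineK ?fin_num_of_finite//; exact: nondecreasing_cvg_mu.
  move=> [|n _ /(_ n (leqnn n))]; first by rewrite divr_gt0.
  move=> /(le_trans (ler_norm _)) /= mAn.
  have [|h1 [h2 [c1 c2 Fh]]] := (FG n).2 (e / 2); first by rewrite divr_gt0.
  exists h1, h2; split => // v w.
  rewrite (splitr e) EFinD -addeA [leRHS]addeC.
  apply: (@le_trans _ _ (defect (F n) v w + (e / 2)%:E)%E); last by rewrite leeD2r.
  have FA : F n `<=` A by exact: bigcup_sup.
  rewrite /defect -EFinD lee_fin.
  have := nuD v w mA (mF n) FA.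
  have := nu_le v w (measurableD mA (mF n)).
  rewrite fine_measureD// => /andP[+ +] nuE; rewrite nuE => h3 h4.
  (* The second summand is a difference of two numbers between 0 and [fine (m A) - fine (m (F n))],
     hence no larger in absolute value. *)
  rewrite (_ : nu v w A - _ = (nu v w (F n) - fine (m (F n)) * c) +
    ((nu v w A - nu v w (F n)) - (fine (m A) - fine (m (F n))) * c)); last by ring.
  apply: (le_trans (ler_normD _ _)); rewrite lerD2l.
  have /andP[c0 c1'] := c01.
  have h5 : 0 <= (fine (m A) - fine (m (F n))) * c by rewrite mulr_ge0//; lra.
  have h6 : (fine (m A) - fine (m (F n))) * c <= fine (m A) - fine (m (F n)).
    by rewrite ler_piMr//; lra.
  rewrite ler_norml; lra.
Qed.

End LambdaSystem.

(** With the whole space in both generators, the cylinders over generators are themselves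
    rectangles, so both projections are measurable for the generated sigma-algebra. *)
Lemma g_sigma_algebra_prod d1 d2 (T1 : measurableType d1) (T2 : measurableType d2)
    (G1 : set (set T1)) (G2 : set (set T2)) :
  @measurable _ T1 = <<s G1 >> -> @measurable _ T2 = <<s G2 >> ->
  G1 setT -> G2 setT ->
  @measurable _ (T1 * T2)%type = <<s [set A `*` B | A in G1 & B in G2] >>.
Proof.
move=> mG1 mG2 G1T G2T; set GG := [set A `*` B | A in G1 & B in G2].
apply/seteqP; split; last first.
  apply: smallest_sub; first exact: sigma_algebra_measurable.
  move=> _ [A GA [B GB <-]]; apply: measurableX.
    by rewrite mG1; exact: sub_sigma_algebra.
  by rewrite mG2; exact: sub_sigma_algebra.
have m1 : @measurable_fun _ _ (g_sigma_algebraType GG) T1 setT fst.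
  apply: (@measurability _ _ (g_sigma_algebraType GG) T1 setT fst G1 mG1) => _ [A GA <-].
  apply: sub_sigma_algebra; exists A => //; exists setT => //.
  by rewrite setTI setXT.
have m2 : @measurable_fun _ _ (g_sigma_algebraType GG) T2 setT snd.
  apply: (@measurability _ _ (g_sigma_algebraType GG) T2 setT snd G2 mG2) => _ [A GA <-].
  apply: sub_sigma_algebra; exists setT => //; exists A => //.
apply: smallest_sub; first exact: smallest_sigma_algebra.
rewrite subUset; split => _ [A mA <-].
  exact: (m1 (@measurableT _ (g_sigma_algebraType GG))).
exact: (m2 (@measurableT _ (g_sigma_algebraType GG))).
Qed.

Lemma setI_closed_prod (T1 T2 : Type) (G1 : set (set T1)) (G2 : set (set T2)) :
  setI_closed G1 -> setI_closed G2 ->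
  setI_closed [set A `*` B | A in G1 & B in G2].
Proof.
move=> I1 I2 _ _ [A GA [B GB <-]] [A' GA' [B' GB' <-]].
rewrite -setXI; exists (A `&` A'); first exact: I1.
by exists (B `&` B') => //; exact: I2.
Qed.

(** * The product action *)

Section WeakMixing.
Variable R : realType.
Variables (P : probability (configM R) R) (S1 S1inv S2 S2inv : RL R -> RL R).
Hypothesis poissonP : is_poisson_law P.
Hypothesis mpS1 : inv_mp S1 S1inv.
Hypothesis mpS2 : inv_mp S2 S2inv.
Hypothesis wmS1 : weakly_mixing_Z (@lamI R) S1 S1inv.
Hypothesis wmS2 : weakly_mixing_Z (@lamI R) S2 S2inv.

Let mP : {measure set (Omega R) -> \bar R} := (((P \x P) \x @lamI R) \x @lamI R)%E.
Let P1 : set (configM R * RL R) -> \bar R := (P \x @lamI R)%E.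
Let T v w : Omega R -> Omega R := hatL S1 S1inv S2 S2inv v w.

(** Configurations are restricted to void events, where decorrelation is explicit; the sides in the
    uniform coordinates are arbitrary Borel sets, since weak mixing of [S1] and [S2] covers them
    all. *)
Definition omega_rects : set (set (Omega R)) :=
  [set A `*` D | A in [set A `*` C | A in
      [set E1 `*` E2 | E1 in @void_sets R & E2 in @void_sets R]
    & C in @measurable _ (RL R)] & D in @measurable _ (RL R)].

Lemma setI_closed_measurable d (X : measurableType d) : setI_closed (@measurable _ X).
Proof. by move=> A B; exact: measurableI. Qed.

Lemma measurable_sigma d (X : measurableType d) : @measurable _ X = <<s @measurable _ X >>.
Proof.
apply/seteqP; split; first exact: sub_sigma_algebra.
by apply: smallest_sub => //; exact: sigma_algebra_measurable.
Qed.

Lemma omega_rects_setI : setI_closed omega_rects.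
Proof.
by do ![apply: setI_closed_prod]; try exact: setI_closed_measurable;
  exact: setI_closed_void.
Qed.

Lemma omega_rects_setT : omega_rects setT.
Proof.
exists setT; last by exists setT; rewrite ?setXTT.
exists setT; last by exists setT; rewrite ?setXTT.
by exists setT; [exact: void_sets_setT|exists setT; rewrite ?setXTT//; exact: void_sets_setT].
Qed.

Lemma measurable_omega_rects : @measurable _ (Omega R) = <<s omega_rects >>.
Proof.
apply: g_sigma_algebra_prod => //; try exact: measurable_sigma; last first.
  exists setT; last by exists setT; rewrite ?setXTT.
  by exists setT; [exact: void_sets_setT|exists setT; rewrite ?setXTT//; exact: void_sets_setT].
apply: g_sigma_algebra_prod => //; try exact: measurable_sigma; last first.
  by exists setT; [exact: void_sets_setT|exists setT; rewrite ?setXTT//; exact: void_sets_setT].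
apply: g_sigma_algebra_prod; try exact: void_sets_setT; exact: measurable_configM_void.
Qed.

Lemma measurable_hatL v w : measurable_fun setT (T v w).
Proof.
have -> : T v w = fun o =>
   (Lshift v o.1.1.1, Lshift w o.1.1.2,
    zit S1 S1inv (scount o.1.1.1 v) o.1.2, zit S2 S2inv (scount o.1.1.2 w) o.2).
  by apply/funext => -[[[mu nu] x] y].
have m1 : measurable_fun [set: Omega R] (fun o : Omega R => o.1.1.1).
  exact: (measurableT_comp measurable_fst (measurableT_comp measurable_fst measurable_fst)).
have m2 : measurable_fun [set: Omega R] (fun o : Omega R => o.1.1.2).
  exact: (measurableT_comp measurable_snd (measurableT_comp measurable_fst measurable_fst)).
have m3 : measurable_fun [set: Omega R] (fun o : Omega R => o.1.2).
  exact: (measurableT_comp measurable_snd measurable_fst).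
apply: measurable_fun_pair; first apply: measurable_fun_pair; first apply: measurable_fun_pair.
- exact: (measurableT_comp (measurable_Lshift v) m1).
- exact: (measurableT_comp (measurable_Lshift w) m2).
- apply: measurable_zit_comp => // z.
  rewrite -[X in measurable X]setTI.
  exact: (m1 measurableT _ (measurable_scount v z)).
- apply: measurable_zit_comp => // z.
  rewrite -[X in measurable X]setTI.
  exact: (m2 measurableT _ (measurable_scount w z)).
Qed.

Lemma measurable_preimage_hatL v w A : measurable A -> measurable (T v w @^-1` A).
Proof. by move=> mA; rewrite -[X in measurable X]setTI; exact: measurable_hatL. Qed.

Lemma void_sets_measurable E : void_sets E -> measurable (E : set (configM R)).
Proof. by move=> vE; rewrite measurable_configM_void; exact: sub_sigma_algebra. Qed.

Lemma hatP_rect (E1 E2 : set (configM R)) (C1 C2 : set (RL R)) :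
  measurable E1 -> measurable E2 -> measurable C1 -> measurable C2 ->
  mP (((E1 `*` E2) `*` C1) `*` C2) = (P1 (E1 `*` C1) * P1 (E2 `*` C2))%E.
Proof.
move=> mE1 mE2 mC1 mC2.
rewrite /P1 -product_measure_interleave; try exact: measurableX.
congr (_ _); apply/seteqP; split => -[[[mu nu] x] y] /=.
  by move=> [[[? ?] ?] ?].
by move=> [[? ?] [? ?]].
Qed.

(** The conditions on (mu, x) involve only [v] and those on (nu, y) only [w], so the correlation is
    a product of two skew-product correlations. *)
Lemma hatP_hatL_rect v w (E1 E2 F1 F2 : set (configM R)) (C1 C2 D1 D2 : set (RL R)) :
  measurable E1 -> measurable E2 -> measurable C1 -> measurable C2 ->
  measurable F1 -> measurable F2 -> measurable D1 -> measurable D2 ->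
  mP (T v w @^-1` (((E1 `*` E2) `*` C1) `*` C2) `&` (((F1 `*` F2) `*` D1) `*` D2)) =
  (P1 (skew S1 S1inv v @^-1` (E1 `*` C1) `&` (F1 `*` D1)) *
   P1 (skew S2 S2inv w @^-1` (E2 `*` C2) `&` (F2 `*` D2)))%E.
Proof.
move=> mE1 mE2 mC1 mC2 mF1 mF2 mD1 mD2.
rewrite /P1 -product_measure_interleave.
- congr (_ _); apply/seteqP; split => -[[[mu nu] x] y] /=; rewrite /skew/=.
    by move=> [[[[? ?] ?] ?] [[[? ?] ?] ?]].
  by move=> [[[? ?] [? ?]] [[? ?] [? ?]]].
- by apply: measurableI; [apply: measurable_preimage_skew => //|]; exact: measurableX.
- by apply: measurableI; [apply: measurable_preimage_skew => //|]; exact: measurableX.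
Qed.

Lemma P1_setT : P1 setT = 1%E.
Proof.
have lT : @lamI R setT = 1%E by exact: (@probability_setT _ _ _ (@lamI R)).
by rewrite /P1 -setXTT product_measure1E//= probability_setT lT mule1.
Qed.

Lemma mP_setT : mP setT = 1%E.
Proof. by rewrite -!setXTT hatP_rect// !setXTT P1_setT mule1. Qed.

Lemma hatL_preserving v w A : measurable A -> mP (T v w @^-1` A) = mP A.
Proof.
move=> mA.
pose nu := measure_function_pushforward__canonical__measure_function_Measure
  mP (measurable_hatL v w).
apply: (measure_unique omega_rects (fun=> setT) measurable_omega_rects
   omega_rects_setI (fun=> omega_rects_setT) _ nu mP _ _ A mA).
- by rewrite bigcup_const.
- move=> _ [_ [_ [E1 /void_sets_measurable mE1 [E2 /void_sets_measurable mE2 <-]]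
    [C1 mC1 <-]] [C2 mC2 <-]].
  rewrite /nu/= /pushforward -[_ @^-1` _]setIT -!setXTT hatP_hatL_rect// hatP_rect//.
  rewrite !setXTT !setIT /P1.
  by congr (_ * _)%E; apply: skew_preserving => //; exact: measurableX.
- by move=> k; rewrite /nu/= /pushforward preimage_setT mP_setT ltry.
Qed.

Let P1_le1 A : measurable A -> (P1 A <= 1)%E.
Proof.
by move=> mA; rewrite -P1_setT; apply: le_measure; rewrite ?inE.
Qed.

Let P1_ge0 A : (0 <= P1 A)%E. Proof. exact: measure_ge0. Qed.

Let mP_fin A : measurable A -> mP A \is a fin_num.
Proof.
by apply: fin_num_of_finite; rewrite mP_setT ltry.
Qed.

Definition correlation v w A B : R := fine (mP (T v w @^-1` A `&` B)).

Definition hat_defect A B v w : \bar R :=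
  (`|correlation v w A B - fine (mP A) * fine (mP B)|)%:E.

Lemma normB_mul_le (a b a' b' : R) : 0 <= a <= 1 -> 0 <= b' <= 1 ->
  `|a * b - a' * b'| <= `|a - a'| + `|b - b'|.
Proof.
move=> /andP[a0 a1] /andP[b0 b1].
rewrite (_ : _ - _ = a * (b - b') + (a - a') * b'); last by ring.
rewrite addrC (le_trans (ler_normD _ _))// !normrM (ger0_norm a0) (ger0_norm b0).
by rewrite lerD// ?ler_piMr// ler_piMl.
Qed.

Lemma hat_defect_rect A B : omega_rects A -> omega_rects B ->
  cesaro_dominated (hat_defect A B).
Proof.
move=> [_ [_ [E1 vE1 [E2 vE2 <-]] [C1 mC1 <-]] [C2 mC2 <-]].
move=> [_ [_ [F1 vF1 [F2 vF2 <-]] [D1 mD1 <-]] [D2 mD2 <-]].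
have [mE1 mE2] := (void_sets_measurable vE1, void_sets_measurable vE2).
have [mF1 mF2] := (void_sets_measurable vF1, void_sets_measurable vF2).
have [K1 H1] := skew_rect_decorrelation poissonP mpS1 vE1 vF1 mC1 mD1.
have [K2 H2] := skew_rect_decorrelation poissonP mpS2 vE2 vF2 mC2 mD2.
move=> e e0; eexists; eexists; split.
- apply: cesaro_nullD; first exact: (cesaro_null_indic K1).
  apply: (cesaro_null_poisson_average (theta := sym_overlap_defect S1 S1inv C1 D1)).
    exact: sym_overlap_defect_ge0.
  by move=> eps eps0; exact: sum_overlap_defect_le.
- apply: cesaro_nullD; first exact: (cesaro_null_indic K2).
  apply: (cesaro_null_poisson_average (theta := sym_overlap_defect S2 S2inv C2 D2)).
    exact: sym_overlap_defect_ge0.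
  by move=> eps eps0; exact: sum_overlap_defect_le.
move=> v w; rewrite -[leLHS]add0e; apply: leeD; first by rewrite lee_fin ltW.
apply: le_trans (leeD (H1 v) (H2 w)).
rewrite /hat_defect /correlation hatP_hatL_rect// !hatP_rect//.
have m1 : measurable (skew S1 S1inv v @^-1` (E1 `*` C1) `&` (F1 `*` D1)).
  by apply: measurableI; [apply: measurable_preimage_skew => //|]; exact: measurableX.
have m2 : measurable (skew S2 S2inv w @^-1` (E2 `*` C2) `&` (F2 `*` D2)).
  by apply: measurableI; [apply: measurable_preimage_skew => //|]; exact: measurableX.
have P1_01 X : measurable X -> exists2 r : R, P1 X = r%:E & 0 <= r <= 1.
  move=> mX; have fX : P1 X \is a fin_num.
    by rewrite ge0_fin_numE// (le_lt_trans (P1_le1 mX))// ltry.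
  exists (fine (P1 X)); first by rewrite fineK.
  by rewrite fine_ge0//= -lee_fin fineK// P1_le1.
rewrite -/P1.
have [a -> a01] := P1_01 _ m1.
have [b -> b01] := P1_01 _ m2.
have [|p1 -> /andP[p10 p11]] := P1_01 (E1 `*` C1); first exact: measurableX.
have [|p2 -> /andP[p20 p21]] := P1_01 (E2 `*` C2); first exact: measurableX.
have [|q1 -> /andP[q10 q11]] := P1_01 (F1 `*` D1); first exact: measurableX.
have [|q2 -> /andP[q20 q21]] := P1_01 (F2 `*` D2); first exact: measurableX.
suff : `|a * b - p1 * p2 * (q1 * q2)| <= `|a - p1 * q1| + `|b - p2 * q2|.
  by rewrite -lee_fin.
rewrite mulrACA; apply: normB_mul_le => //.
by rewrite mulr_ge0//= -[1]mulr1 ler_pM.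
Qed.

Lemma hat_defectE A B v w : measurable A -> measurable B ->
  hat_defect A B v w = (`|mP (T v w @^-1` A `&` B) - mP A * mP B|)%E.
Proof.
move=> mA mB; rewrite /hat_defect /correlation.
have fAB : mP (T v w @^-1` A `&` B) \is a fin_num.
  by apply: mP_fin; apply: measurableI => //; exact: measurable_preimage_hatL.
by rewrite -[in RHS](fineK fAB) -[in RHS](fineK (mP_fin mA)) -[in RHS](fineK (mP_fin mB)).
Qed.

Lemma hat_defect_dominated A0 B0 : measurable A0 -> measurable B0 ->
  cesaro_dominated (hat_defect A0 B0).
Proof.
have mPT : (mP setT < +oo)%E by rewrite mP_setT ltry.
have f01 A : measurable A -> 0 <= fine (mP A) <= 1.
  move=> mA; rewrite fine_ge0//= -lee_fin fineK ?mP_fin// -mP_setT.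
  by apply: le_measure; rewrite ?inE.
have mI v w A B : measurable A -> measurable B -> measurable (T v w @^-1` A `&` B).
  by move=> mA mB; apply: measurableI => //; exact: measurable_preimage_hatL.
have fineD_sub A B := @fine_measureD _ _ _ mP mPT A B.
have corr_le v w A B X : measurable A -> measurable B -> measurable X ->
    (mP (T v w @^-1` A `&` B) <= mP X)%E -> 0 <= correlation v w A B <= fine (mP X).
  move=> mA mB mX h; rewrite fine_ge0//=; apply: fine_le => //; apply: mP_fin => //.
  exact: mI.
(* The whole space has zero defect against any event: by invariance of the measure when it is the
   second event, trivially when it is the first. *)
have defectT A : measurable A -> cesaro_dominated (hat_defect A setT) /\
    cesaro_dominated (hat_defect setT A).
  have z : cesaro_null (fun=> 0%E : \bar R).
    split => // e e0; near=> r; rewrite integral0 lee_fin mulr_ge0// ltW//.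
  move=> mA; split => e e0; exists (fun=> 0%E), (fun=> 0%E); split => // v w;
    rewrite !adde0 /hat_defect /correlation.
    by rewrite setIT hatL_preserving// mP_setT mulr1 subrr normr0 lee_fin ltW.
  by rewrite preimage_setT setTI mP_setT mul1r subrr normr0 lee_fin ltW.
have rect_meas A : omega_rects A -> measurable A.
  by rewrite measurable_omega_rects; exact: sub_sigma_algebra.
(* The second event is extended while the first stays a rectangle; here [nu_le] is plain inclusion
   in [B]. *)
have rect_l A : omega_rects A -> forall B, measurable B -> cesaro_dominated (hat_defect A B).
  move=> rA; have mA := rect_meas _ rA.
  have nuD v w B B' : measurable B -> measurable B' -> B' `<=` B ->
      correlation v w A (B `\` B') = correlation v w A B - correlation v w A B'.
    move=> mB mB' BB'; rewrite /correlation setIDA -fineD_sub//; try exact: mI.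
      congr (fine (mP _)); apply/seteqP; split => o /= [[h1 h2] h3].
        by split => // -[].
      by split => // ?; apply: h3.
    exact: setIS.
  have nu_le v w B : measurable B -> 0 <= correlation v w A B <= fine (mP B).
    move=> mB; apply: corr_le => //; apply: le_measure; rewrite ?inE//; exact: mI.
  have E B : (fun v w => (`|correlation v w A B - fine (mP B) * fine (mP A)|)%:E) =
      hat_defect A B by rewrite /hat_defect mulrC.
  have ls := cesaro_dominated_lambda_system mPT (f01 _ mA) nuD nu_le.
  rewrite E in ls.
  have {}ls := ls (defectT _ mA).1.
  move=> B; rewrite measurable_omega_rects => sB.
  have [] // := lambda_system_subset omega_rects_setI ls _ (fun X _ => @subsetT _ X) sB.
    by move=> X rX; rewrite /= E; split; [exact: rect_meas|exact: hat_defect_rect].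
  by rewrite E.
move: A0 B0 => A B mA mB.
have nuD v w X X' : measurable X -> measurable X' -> X' `<=` X ->
    correlation v w (X `\` X') B = correlation v w X B - correlation v w X' B.
  move=> mX mX' XX'; rewrite /correlation -fineD_sub//; try exact: mI.
    congr (fine (mP _)); apply/seteqP; split => o /=.
      by move=> [[h1 h2] h3]; split => // -[].
    by move=> [[h1 h2] h3]; split => //; split => // ?; apply: h3.
  by apply: setSI => o; exact: XX'.
(* With the first event varying, the correlation is bounded by the measure of the preimage of [X],
   and invariance turns this into [mP X]. *)
have nu_le v w X : measurable X -> 0 <= correlation v w X B <= fine (mP X).
  move=> mX; apply: corr_le => //; rewrite -(hatL_preserving v w mX).
  apply: le_measure; rewrite ?inE//; [exact: mI|exact: measurable_preimage_hatL].
have ls := cesaro_dominated_lambda_system mPT (f01 _ mB) nuD nu_le (defectT _ mB).2.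
move: mA; rewrite measurable_omega_rects => sA.
have [] // := lambda_system_subset omega_rects_setI ls _ (fun X _ => @subsetT _ X) sA.
by move=> X rX; split; [exact: rect_meas|exact: rect_l].
Unshelve. all: by end_near. Qed.

End WeakMixing.

Theorem theorem4 (R : realType) (P : probability (configM R) R)
  (S1 S1inv S2 S2inv : RL R -> RL R) :
  is_poisson_law P ->
  inv_mp S1 S1inv -> inv_mp S2 S2inv ->
  weakly_mixing_Z (@lamI R) S1 S1inv ->
  weakly_mixing_Z (@lamI R) S2 S2inv ->
  weakly_mixing_R2 (hatP P) (hatL S1 S1inv S2 S2inv).
Proof.
move=> poissonP mpS1 mpS2 wmS1 wmS2; split.
  move=> v w; split; first exact: measurable_hatL.
  by move=> A mA; exact: hatL_preserving.
move=> A B mA mB.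
have dom := hat_defect_dominated poissonP mpS1 mpS2 wmS1 wmS2 mA mB.
have := cesaro_dominated_cvg _ dom.
move=> /(_ (fun v w => normr_ge0 _)); apply: cvg_trans; apply: near_eq_cvg.
apply: nearW => r /=; congr (_ * _)%E; apply: eq_integral => g _.
exact: hat_defectE.
Qed.
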